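(* Fix $n\in\mathbb N$ and two normed spaces $\mathbf X=(\mathbb R^n,\|\cdot\|_{\mathbf X})$, $\mathbf Y=(\mathbb R^n,\|\cdot\|_{\mathbf Y})$. Every closed $\mathscr C\subseteq\mathbb R^n$ containing at least two points satisfies $$\mathsf{SEP}(\mathscr C_{\mathbf X})\le4\Bigg(\sup_{x,y\in\mathscr C,\ x\ne y}\frac{\|x-y\|_{\mathbf X}}{\|x-y\|_{\mathbf Y}}\Bigg)\sup_{x,y\in\mathscr C,\ x\ne y}\Bigg(\frac{\mathrm{vol}_{n-1}\big(\mathrm{Proj}_{(x-y)^\perp}(B_{\mathbf Y})\big)}{\mathrm{vol}_n(B_{\mathbf Y})}\cdot\frac{\|x-y\|_{\ell_2^n}}{\|x-y\|_{\mathbf X}}\Bigg).$$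
   Context: $B_{\mathbf Y}$ is the closed unit ball of $\mathbf Y$; $\mathscr C_{\mathbf X}$ denotes the set $\mathscr C$ equipped with the metric inherited from $\|\cdot\|_{\mathbf X}$; for $z\in\mathbb R^n\setminus\{0\}$, $\mathrm{Proj}_{z^\perp}$ is the orthogonal projection (for the standard Euclidean structure) onto the hyperplane $z^\perp$; $\mathrm{vol}_s$ is $s$-dimensional Hausdorff measure. Separation modulus: a random partition $\mathscr P$ of a metric space $(\mathcal M,d_{\mathcal M})$ consists of a probability space $(\Omega,\mathbf{Prob})$ and set-valued mappings $\Gamma^k:\Omega\to2^{\mathcal M}$, $k\in\mathbb N$, such that $\mathscr P^\omega=\{\Gamma^k(\omega)\}_{k=1}^\infty$ is a partition of $\mathcal M$ for every $\omega\in\Omega$ (empty clusters are allowed) and each $\Gamma^k$ is strongly measurable, i.e., $\{\omega:\ E\cap\Gamma^k(\omega)\neq\emptyset\}$ is $\mathbf{Prob}$-measurable for every closed $E\subseteq\mathcal M$. $\mathscr P(x)$ denotes the cluster containing $x$. $\mathscr P$ is $\Delta$-bounded if every cluster of $\mathscr P^\omega$ has $d_{\mathcal M}$-diameter at most $\Delta$, for every $\omega$. A $\Delta$-bounded $\mathscr P$ is $\sigma$-separating if $\mathbf{Prob}[\mathscr P(x)\ne\mathscr P(y)]\le\frac{\sigma}{\Delta}d_{\mathcal M}(x,y)$ for all $x,y\in\mathcal M$. $\mathsf{SEP}(\mathcal M)$ is the infimum over those $\sigma>0$ such that for every $\Delta>0$ there is a $\sigma$-separating $\Delta$-bounded random partition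 of $\mathcal M$ ($\infty$ if there is no such $\sigma$). *)

(* Defs.v *)
(* MathComp-Analysis *)
From HB Require Import structures.
From mathcomp Require Import all_boot all_order all_algebra.
From mathcomp Require Import all_classical all_reals all_analysis.
From mathcomp Require Import ring lra.

Set Implicit Arguments.
Unset Strict Implicit.
Unset Printing Implicit Defensive.

Import Order.TTheory GRing.Theory Num.Theory.
Import numFieldNormedType.Exports.

Local Open Scope classical_set_scope.
Local Open Scope ring_scope.

Record norm (R : realType) (n : nat) := Norm {
  norm_fun :> 'rV[R]_n -> R ;
  norm_triangle : forall x y, norm_fun (x + y) <= norm_fun x + norm_fun y ;
  norm_homogeneous : forall (a : R) x, norm_fun (a *: x) = `|a| * norm_fun x ;
  norm_definite : forall x, norm_fun x = 0 -> x = 0 }.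

Definition unit_ball (R : realType) (n : nat) (N : norm R n) : set 'rV[R]_n :=
  [set x | N x <= 1].

(* An alias of R^n carrying the metric of [N], as opposed to the sup metric that
   the library puts on ['rV[R]_n]. *)
Definition normed_space (R : realType) (n : nat) (N : norm R n) : Type :=
  'rV[R]_n.

Section normed_space_metric.
Context (R : realType) (n : nat) (N : norm R n).

Let dist (x y : 'rV[R]_n) : R := N (x - y).

Let distxx x : dist x x = 0.
Proof. by rewrite /dist subrr -(scale0r 0) norm_homogeneous normr0 mul0r. Qed.

Let dist_positivity x y : dist x y = 0 -> x = y.
Proof. by move=> /norm_definite /eqP; rewrite subr_eq0 => /eqP. Qed.

Let dist_sym x y : dist x y = dist y x.
Proof.
by rewrite /dist -opprB -scaleN1r norm_homogeneous normrN normr1 mul1r.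
Qed.

Let dist_triangle y x z : dist x z <= dist x y + dist y z.
Proof. by rewrite /dist -(subrKA y x) norm_triangle. Qed.

HB.instance Definition _ := Choice.copy (normed_space N) 'rV[R]_n.
HB.instance Definition _ := @isMetric.Build R (normed_space N) dist
  distxx dist_positivity dist_sym dist_triangle.

End normed_space_metric.

(* An alias of [set_type A], on which the library only has the initial
   pseudometric structure. *)
Definition metric_subspace (R : realType) (M : metricType R) (A : set M) : Type :=
  set_type A.

Section metric_subspace_metric.
Context (R : realType) (M : metricType R) (A : set M).

Let dist (x y : set_type A) : R := mdist (set_val x) (set_val y).

Let distxx x : dist x x = 0.
Proof. exact: mdistxx. Qed.

Let dist_positivity x y : dist x y = 0 -> x = y.
Proof. by move=> /mdist_positivity /val_inj. Qed.

Let dist_sym x y : dist x y = dist y x.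
Proof. exact: metric_sym. Qed.

Let dist_triangle y x z : dist x z <= dist x y + dist y z.
Proof. exact: metric_triangle. Qed.

HB.instance Definition _ := Choice.copy (metric_subspace A) (set_type A).
HB.instance Definition _ := @isMetric.Build R (metric_subspace A) dist
  distxx dist_positivity dist_sym dist_triangle.

End metric_subspace_metric.

Definition dot (R : realType) (n : nat) (x y : 'rV[R]_n) : R :=
  \sum_(i < n) x 0 i * y 0 i.

Section l2norm.
Context (R : realType) (n : nat).
Implicit Types x y : 'rV[R]_n.

Let l2 x : R := Num.sqrt (dot x x).

Let dot_ge0 x : 0 <= dot x x.
Proof. by apply: sumr_ge0 => i _; rewrite -expr2 sqr_ge0. Qed.

Let dotC x y : dot x y = dot y x.
Proof. by apply: eq_bigr => i _; rewrite mulrC. Qed.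

Let dotDl x y z : dot (x + y) z = dot x z + dot y z.
Proof. by rewrite -big_split; apply: eq_bigr => i _; rewrite !mxE mulrDl. Qed.

Let dotZl a x y : dot (a *: x) y = a * dot x y.
Proof. by rewrite mulr_sumr; apply: eq_bigr => i _; rewrite !mxE mulrA. Qed.

Let dot0 x : dot x x = 0 -> x = 0.
Proof.
move=> /eqP; rewrite psumr_eq0; last by move=> i _; rewrite -expr2 sqr_ge0.
move=> /allP x0; apply/rowP => i; rewrite mxE.
by have := x0 i; rewrite mem_index_enum mulf_eq0 orbb => /(_ isT) /eqP.
Qed.

Let cauchy_schwarz x y : dot x y ^+ 2 <= dot x x * dot y y.
Proof.
have [y0|y0] := eqVneq (dot y y) 0.
  rewrite y0 mulr0 (dot0 y0) dotC -(scale0r 0) dotZl mul0r expr0n/=; exact: lexx.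
have yy : 0 < dot y y by rewrite lt_def y0 dot_ge0.
have := dot_ge0 (dot y y *: x + (- dot x y) *: y).
rewrite dotDl !dotZl !(dotC _ (_ + _)) !dotDl !dotZl (dotC y x) => h.
rewrite -(ler_pM2l yy) -subr_ge0; apply: le_trans h _.
by rewrite le_eqVlt; apply/orP; left; apply/eqP; ring.
Qed.

Let l2_triangle x y : l2 (x + y) <= l2 x + l2 y.
Proof.
have sq u : l2 u ^+ 2 = dot u u by rewrite sqr_sqrtr.
rewrite -(@ler_pXn2r _ 2)// ?nnegrE ?addr_ge0 ?sqrtr_ge0//.
rewrite sqrrD !sq dotDl !(dotC _ (_ + _)) !dotDl (dotC y x).
have : dot x y <= l2 x * l2 y.
  rewrite (le_trans (ler_norm _))// -(@ler_pXn2r _ 2)// ?nnegrE ?mulr_ge0 ?sqrtr_ge0//.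
  by rewrite exprMn !sq real_normK ?num_real.
lra.
Qed.

Let l2_homogeneous a x : l2 (a *: x) = `|a| * l2 x.
Proof.
by rewrite /l2 dotZl dotC dotZl mulrA -expr2 sqrtrM ?sqr_ge0// sqrtr_sqr.
Qed.

Let l2_definite x : l2 x = 0 -> x = 0.
Proof.
by move=> /eqP; rewrite sqrtr_eq0 => x0; apply: dot0; apply/le_anti; rewrite x0/=.
Qed.

Definition l2norm : norm R n := Norm l2_triangle l2_homogeneous l2_definite.

End l2norm.

Arguments l2norm {R n}.

Notation euclidean_space R n := (normed_space (@l2norm R n)).

Definition proj_orth (R : realType) (n : nat) (z x : 'rV[R]_n) : 'rV[R]_n :=
  x - (dot x z / dot z z) *: z.

Section hausdorff_measure.
Local Open Scope ereal_scope.
Context (R : realType).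

Definition diam (M : metricType R) (A : set M) : \bar R :=
  maxe 0 (ereal_sup [set (mdist p.1 p.2)%:E | p in A `*` A]).

(* The empty set must weigh 0 also when [s = 0], whereas [0 ^+ 0 = 1]; thus the
   0-dimensional measure counts points. *)
Definition hausdorff_weight (M : metricType R) (s : nat) (A : set M) : \bar R :=
  if A == set0 then 0 else diam A ^+ s.

Definition hausdorff_content (M : metricType R) (s : nat) (delta : R)
    (A : set M) : \bar R :=
  ereal_inf [set \sum_(0 <= k <oo) hausdorff_weight s (U k) |
    U in [set U : (set M)^nat |
           A `<=` \bigcup_k U k /\ forall k, diam (U k) <= delta%:E]].

Definition hausdorff_measure (M : metricType R) (s : nat) (A : set M) : \bar R :=
  ereal_sup [set hausdorff_content s delta A | delta in [set r : R | (0 < r)%R]].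

Definition unit_cube (n : nat) : set (euclidean_space R n) :=
  [set x : 'rV[R]_n | forall i, (0 <= x ord0 i <= 1)%R].

(* The [s]-dimensional Hausdorff measure of a subset of Euclidean space,
   normalized so that the unit cube of [R^s] has measure 1, i.e., so that it
   agrees with Lebesgue measure on [R^s]. *)
Definition vol (n s : nat) (A : set 'rV[R]_n) : \bar R :=
  hausdorff_measure s (A : set (euclidean_space R n)) /
  hausdorff_measure s (@unit_cube s).

End hausdorff_measure.

(* Clusters may be empty, so the library's [partition], which requires nonempty
   blocks, is not used. *)
Record random_partition (R : realType) (M : metricType R) := RandomPartition {
  rp_display : measure_display ;
  rp_space : measurableType rp_display ;
  rp_prob : probability rp_space R ;
  rp_set : nat -> rp_space -> set M ;
  rp_cover : forall w, \bigcup_k rp_set k w = setT ;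
  rp_disjoint : forall w, trivIset setT (fun k => rp_set k w) ;
  rp_measurable : forall k (E : set M), closed E ->
    measurable [set w | E `&` rp_set k w !=set0] }.

Section separation_modulus.
Context (R : realType) (M : metricType R).
Implicit Types P : random_partition M.

Definition cluster_of P (w : rp_space P) (x : M) : set M :=
  \bigcup_(k in [set k | rp_set k w x]) rp_set k w.

Definition bounded_partition (Delta : R) P :=
  forall w k, (diam (@rp_set _ _ P k w) <= Delta%:E)%E.

Definition separating (sigma Delta : R) P :=
  forall x y : M,
    (rp_prob P [set w | cluster_of w x <> cluster_of w y] <=
       (sigma / Delta * mdist x y)%:E)%E.

Definition SEP : \bar R :=
  ereal_inf [set sigma%:E | sigma in [set sigma : R | 0 < sigma /\
    forall Delta, 0 < Delta ->
      exists P, bounded_partition Delta P /\ separating sigma Delta P]].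

End separation_modulus.

Arguments SEP {R} M.

Definition distinct_pairs (T : Type) (C : set T) : set (T * T) :=
  [set p | [/\ C p.1, C p.2 & p.1 <> p.2]].

(* Main.v *)
Require Import Defs.
From HB Require Import structures.
From mathcomp Require Import all_boot all_order all_algebra all_fingroup.
From mathcomp Require Import all_classical all_reals all_analysis.
From mathcomp Require Import measurable_realfun.
From mathcomp Require Import ring lra.

Set Implicit Arguments.
Unset Strict Implicit.
Unset Printing Implicit Defensive.

Import Order.TTheory GRing.Theory Num.Theory.
Import numFieldNormedType.Exports.

Local Open Scope classical_set_scope.
Local Open Scope ring_scope.

(** Let [alpha] and [beta] be the two suprema, [B] the unit ball of [Y] and
    [r = Delta / (2 alpha)].  Balls of radius [r] for [Y], whose traces on [C] have
    [X]-diameter at most [2 r alpha = Delta], are placed around the points of a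
    fine lattice that is shifted at random, the lattice points are put in random
    order, and every point of [C] goes to the first ball that contains it.

    Two points [x] and [y] are separated only if the first center in the union of
    the balls [x + rB] and [y + rB] lies in just one of them.  In a random order
    this has conditional probability equal to the number of centers in the
    symmetric difference over the number of centers in the union.  Averaging over
    the shift turns the numerator into the volume of the symmetric difference
    ([sum_haus_lattice_trace]), and the denominator is always almost the volume of
    [rB] ([count_lattice_classes]), both in units of the volume of a cell of the
    lattice.  Hence the probability is at most about
    [2 vol (rB \ (z + rB)) / vol (rB)], where [z = y - x].

    Since [B] is convex, a line parallel to [z] meets [rB \ (z + rB)] in an
    interval of length at most [|z|], whence
    [vol_n (rB \ (z + rB)) <= |z| vol_(n-1) (Proj (rB))] for the projection along
    [z] ([haus_shift_le]).  The ratio becomes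
    [4 alpha beta X (x - y) / Delta] up to a factor that tends to 1 with the mesh
    of the lattice, which an infimum over [sigma] does not see.

    The law of the shift is the [n]-dimensional Hausdorff measure, restricted to
    a unit cube.  It is invariant under isometries and scales like a volume for
    trivial reasons, so that all volumes above are computed from three facts:
    closed sets are measurable ([closed_caratheodory]), the measure of a cube is
    positive and finite ([haus_unit_cube_gt0], [haus_cube_fin]), and [R^n] is
    tiled by cubes.  As to the random order, the lattice is divided into finitely
    many classes such that points of the same class are far apart, and it is the
    classes that are permuted, uniformly at random ([exists_random_order]). *)

(** * Sums and powers of extended reals *)

Section ereal_facts.
Context {R : realType}.
Local Open Scope ereal_scope.
Implicit Types x y : \bar R.

Lemma lee_expe x y (n : nat) : 0 <= x -> x <= y -> x ^+ n <= y ^+ n.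
Proof.
move=> x0 xy; elim: n => [|n IHn]; first by rewrite !expe0.
by rewrite !expeS lee_pmul// expe_ge0.
Qed.

Lemma expeMn x y (n : nat) : (x * y) ^+ n = x ^+ n * y ^+ n.
Proof.
elim: n => [|n IHn]; first by rewrite !expe0 mule1.
by rewrite !expeS IHn muleACA.
Qed.

Lemma ereal_supD_le (T1 T2 : Type) (P : set T1) (Q : set T2) (f : T1 -> \bar R)
    (g : T2 -> \bar R) (c : \bar R) : P !=set0 -> Q !=set0 ->
    (forall i, P i -> 0 <= f i) -> (forall j, Q j -> 0 <= g j) ->
    (forall i j, P i -> Q j -> f i + g j <= c) ->
  ereal_sup [set f i | i in P] + ereal_sup [set g j | j in Q] <= c.
Proof.
move=> [i0 Pi0] [j0 Qj0] f0 g0 fgc.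
have c0 : 0 <= c by apply: le_trans (fgc _ _ Pi0 Qj0); rewrite adde_ge0 ?f0 ?g0.
case: c c0 fgc => [c|_ _|//]; last by rewrite leey.
move=> c0 fgc.
have gfin j : Q j -> g j \is a fin_num.
  move=> Qj; rewrite ge0_fin_numE ?g0//; apply: le_lt_trans (ltry c).
  by apply: le_trans (fgc _ _ Pi0 Qj); rewrite leeDr ?f0.
have supf j : Q j -> ereal_sup [set f i | i in P] <= c%:E - g j.
  move=> Qj; apply: ge_ereal_sup => _ [i Pi <-].
  by rewrite leeBrDr ?gfin// fgc.
have supf0 : 0 <= ereal_sup [set f i | i in P].
  by apply: le_ereal_sup_tmp; exists (f i0); [exists i0|exact: f0].
have supfin : ereal_sup [set f i | i in P] \is a fin_num.
  rewrite ge0_fin_numE//; apply: le_lt_trans (supf _ Qj0) _.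
  by rewrite -(fineK (gfin _ Qj0)) -EFinB ltry.
rewrite -leeBrDl//; apply: ge_ereal_sup => _ [j Qj <-].
by rewrite leeBrDl// -leeBrDr ?gfin// supf.
Qed.

(** A double series as a single one, for covering a union by the covers of its
    members. *)
Lemma nneseries_pair (a : nat -> nat -> \bar R) :
    (forall i j, 0 <= a i j) ->
  exists2 f : nat -> nat * nat, set_bij setT setT f &
    \sum_(0 <= k <oo) a (f k).1 (f k).2 =
    \sum_(0 <= i <oo) \sum_(0 <= j <oo) a i j.
Proof.
move=> a0; have /card_esym/ppcard_eqP[f] := card_nat2.
exists f; first exact: bij.
rewrite nneseries_esumT//.
rewrite -(@reindex_esum _ _ _ setT setT f (fun p => a p.1 p.2)); last exact: bij.
rewrite nneseries_esumT; last by move=> i; exact: nneseries_ge0.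
rewrite (_ : setT = setT `*`` (fun=> setT)); last by apply/seteqP; split.
by rewrite -esum_esum//; apply: eq_esum => i _; rewrite nneseries_esumT.
Qed.

End ereal_facts.

(** * Hausdorff measure as an outer measure *)

Section hausdorff_outer_measure.
Context {R : realType}.
Local Open Scope ereal_scope.

Lemma diam_ge0 (M : metricType R) (A : set M) : 0 <= diam A.
Proof. by rewrite /diam le_max lexx. Qed.

Lemma diam_leP (M : metricType R) (A : set M) (d : R) : (0 <= d)%R ->
  (diam A <= d%:E <-> forall x y, A x -> A y -> (mdist x y <= d)%R).
Proof.
move=> d0; rewrite /diam ge_max lee_fin d0/=; split.
  move=> /ereal_supP h x y Ax Ay; rewrite -lee_fin; apply: h.
  by exists (x, y).
by move=> h; apply/ereal_supP => _ [[x y] [/= Ax Ay] <-]; rewrite lee_fin h.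
Qed.

Lemma mdist_le_diam (M : metricType R) (A : set M) x y :
  A x -> A y -> (mdist x y)%:E <= diam A.
Proof.
move=> Ax Ay; rewrite /diam le_max; apply/orP; right.
by apply: ereal_sup_ubound; exists (x, y).
Qed.

Lemma le_diam (M : metricType R) (A B : set M) : A `<=` B -> diam A <= diam B.
Proof.
move=> AB; rewrite {1}/diam ge_max diam_ge0/=.
by apply/ereal_supP => _ [[x y] [/= Ax Ay] <-]; apply: mdist_le_diam; apply: AB.
Qed.

Lemma hausdorff_weight_ge0 (M : metricType R) s (A : set M) :
  0 <= hausdorff_weight s A.
Proof. by rewrite /hausdorff_weight; case: ifP => // _; rewrite expe_ge0 ?diam_ge0. Qed.

Lemma hausdorff_weight0 (M : metricType R) s :
  hausdorff_weight s (set0 : set M) = 0.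
Proof. by rewrite /hausdorff_weight eqxx. Qed.

Lemma le_hausdorff_weight (M : metricType R) s (A B : set M) :
  A `<=` B -> hausdorff_weight s A <= hausdorff_weight s B.
Proof.
move=> AB; rewrite {1}/hausdorff_weight; case: ifPn => [_|/set0P[x Ax]].
  exact: hausdorff_weight_ge0.
rewrite /hausdorff_weight ifF ?lee_expe ?diam_ge0 ?le_diam//.
by apply/negbTE/set0P; exists x; apply: AB.
Qed.

Context (M : metricType R).
Implicit Types (A B : set M) (s : nat).

Lemma hausdorff_content_ge0 s d A : 0 <= hausdorff_content s d A.
Proof.
apply: le_ereal_inf_tmp => _ [U _ <-].
by apply: nneseries_ge0 => k _ _; exact: hausdorff_weight_ge0.
Qed.

Lemma hausdorff_content_le s d A (U : (set M)^nat) :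
    A `<=` \bigcup_k U k -> (forall k, diam (U k) <= d%:E) ->
  hausdorff_content s d A <= \sum_(0 <= k <oo) hausdorff_weight s (U k).
Proof. by move=> AU dU; apply: ereal_inf_lbound; exists U. Qed.

Lemma hausdorff_content_sigma_subadditive s d :
  (0 < d)%R -> sigma_subadditive (@hausdorff_content R M s d).
Proof.
move=> d0 F; have [[i ioo]|] := pselect (exists i, hausdorff_content s d (F i) = +oo).
  rewrite (eseries_pinfty _ _ ioo) ?leey// => n _.
  by rewrite -ltNye (lt_le_trans _ (hausdorff_content_ge0 _ _ _)).
rewrite -forallNE => Foo; apply/lee_addgt0Pr => e e0.
apply: le_trans (epsilon_trick _ _ (ltW e0)); last first.
  by move=> n; exact: hausdorff_content_ge0.
have /choice[U PU] n : exists U : (set M)^nat,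
    [/\ F n `<=` \bigcup_k U k, forall k, diam (U k) <= d%:E &
     \sum_(0 <= k <oo) hausdorff_weight s (U k) <=
       hausdorff_content s d (F n) + (e / (2 ^ n.+1)%:R)%:E].
  have en : (0 < e / (2 ^ n.+1)%:R)%R by rewrite divr_gt0.
  have fin : hausdorff_content s d (F n) \is a fin_num.
    by rewrite ge0_fin_numE ?hausdorff_content_ge0// ltey; apply/eqP/Foo.
  have [_ [U [FU dU] <-] /ltW h] := lb_ereal_inf_adherent en fin.
  by exists U.
have [f fbij fsum] := nneseries_pair
  (fun i j => hausdorff_weight_ge0 s (U i j)).
apply: le_trans (_ : _ <= \sum_(0 <= i <oo) \sum_(0 <= j <oo)
    hausdorff_weight s (U i j)) _; last first.
  apply: lee_nneseries => n *; last by have [] := PU n.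
  by apply: nneseries_ge0 => *; exact: hausdorff_weight_ge0.
rewrite -fsum; apply: hausdorff_content_le => [x [i _ Fix]|k]; last first.
  by have [_ + _] := PU (f k).1; exact.
have [/(_ _ Fix)[j _ Ux] _ _] := PU i.
have [_ _ /(_ (i, j) I)[k _ fk]] := fbij.
by exists k => //; rewrite fk.
Qed.

Lemma hausdorff_content0 s d : (0 < d)%R -> hausdorff_content s d (set0 : set M) = 0.
Proof.
move=> d0; apply/eqP; rewrite eq_le hausdorff_content_ge0 andbT.
apply: le_trans (hausdorff_content_le s (sub0set (\bigcup_k (fun=> set0) k)) _) _.
  by move=> _; apply/diam_leP => //; exact: ltW.
by rewrite eseries0// => *; exact: hausdorff_weight0.
Qed.

Lemma le_hausdorff_content s d d' A B : (d' <= d)%R -> A `<=` B ->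
  hausdorff_content s d A <= hausdorff_content s d' B.
Proof.
move=> dd AB; apply: le_ereal_inf_tmp => _ [U [BU dU] <-].
apply: hausdorff_content_le => [|k]; first exact: subset_trans BU.
by apply: le_trans (dU k) _; rewrite lee_fin.
Qed.

Lemma hausdorff_measure_ge s d A : (0 < d)%R ->
  hausdorff_content s d A <= hausdorff_measure s A.
Proof. by move=> d0; apply: ereal_sup_ubound; exists d. Qed.

Lemma hausdorff_measure_leP s A x :
  (forall d : R, (0 < d)%R -> hausdorff_content s d A <= x) ->
  hausdorff_measure s A <= x.
Proof. by move=> h; apply: ge_ereal_sup => _ [d d0 <-]; exact: h. Qed.

Lemma hausdorff_measure_ge0 s A : 0 <= hausdorff_measure s A.
Proof.
exact: le_trans (hausdorff_content_ge0 _ _ _) (hausdorff_measure_ge s A ltr01).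
Qed.

Lemma hausdorff_measure0 s : hausdorff_measure s (set0 : set M) = 0.
Proof.
apply/eqP; rewrite eq_le hausdorff_measure_ge0 andbT.
by apply: hausdorff_measure_leP => d d0; rewrite hausdorff_content0.
Qed.

Lemma le_hausdorff_measure s :
  {homo @hausdorff_measure R M s : A B / A `<=` B >-> A <= B}.
Proof.
move=> A B AB; apply: hausdorff_measure_leP => d d0.
by apply: le_trans (hausdorff_measure_ge s B d0); exact: le_hausdorff_content.
Qed.

Lemma hausdorff_measure_sigma_subadditive s :
  sigma_subadditive (@hausdorff_measure R M s).
Proof.
move=> F; apply: hausdorff_measure_leP => d d0.
apply: le_trans (hausdorff_content_sigma_subadditive s d0 F) _.
apply: lee_nneseries => *; first exact: hausdorff_content_ge0.
exact: hausdorff_measure_ge.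
Qed.

HB.instance Definition _ s := isOuterMeasure.Build R M (@hausdorff_measure R M s)
  (@hausdorff_measure0 s) (@hausdorff_measure_ge0 s) (@le_hausdorff_measure s)
  (@hausdorff_measure_sigma_subadditive s).

(** Sets at distance [e] from each other do not share any covering set of
    diameter less than [e], so that a fine cover of their union splits into
    covers of each. *)
Lemma hausdorff_measure_separated s A B (e : R) : (0 < e)%R ->
    (forall a b, A a -> B b -> (e <= mdist a b)%R) ->
  hausdorff_measure s A + hausdorff_measure s B <= hausdorff_measure s (A `|` B).
Proof.
move=> e0 eAB; apply: ereal_supD_le; try by exists 1%R => /=.
- by move=> *; exact: hausdorff_content_ge0.
- by move=> *; exact: hausdorff_content_ge0.
move=> d1 d2 /= d10 d20; pose d := Num.min (e / 2)%R (Num.min d1 d2).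
have d0 : (0 < d)%R by rewrite !lt_min d10 d20 divr_gt0.
apply: le_trans (hausdorff_measure_ge _ _ d0).
apply: le_ereal_inf_tmp => _ [U [ABU dU] <-].
have split_le C d' : (d <= d')%R -> C `<=` A `|` B -> hausdorff_content s d' C <=
    \sum_(0 <= k <oo) hausdorff_weight s (U k `&` C).
  move=> dd CAB; apply: hausdorff_content_le => [x Cx|k].
    by have [k _ Ux] := ABU _ (CAB _ Cx); exists k.
  apply: le_trans (le_diam (@subIsetl _ _ _)) _.
  by apply: le_trans (dU k) _; rewrite lee_fin.
apply: le_trans (leeD (split_le A d1 _ _) (split_le B d2 _ _)) _ => //.
- by rewrite !ge_min lexx !orbT.
- by rewrite !ge_min lexx !orbT.
rewrite -nneseriesD; [|by move=> *; exact: hausdorff_weight_ge0..].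
apply: lee_nneseries => k *; first by rewrite adde_ge0// hausdorff_weight_ge0.
have [UA0|/set0P[a [Ua Aa]]] := eqVneq (U k `&` A) set0.
  by rewrite UA0 hausdorff_weight0 add0e le_hausdorff_weight.
have [UB0|/set0P[b [Ub Bb]]] := eqVneq (U k `&` B) set0.
  by rewrite UB0 hausdorff_weight0 adde0 le_hausdorff_weight.
have := le_trans (mdist_le_diam Ua Ub) (dU k); rewrite lee_fin => abd.
have := le_trans (eAB _ _ Aa Bb) abd; rewrite !le_min => /andP[+ _].
by rewrite leNgt ltr_pdivrMr// ltr_pMr// ltr1n.
Qed.

End hausdorff_outer_measure.

Section lipschitz.
Context {R : realType} (M N : metricType R).
Local Open Scope ereal_scope.

(** A [k]-Lipschitz image of a cover is a cover whose diameters have grown at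
    most by [k]. *)
Lemma lipschitz_hausdorff_measure s (k : R) (f : M -> N) (A : set M) :
    (0 < k)%R ->
    (forall x y, A x -> A y -> (mdist (f x) (f y) <= k * mdist x y)%R) ->
  hausdorff_measure s (f @` A) <= (k ^+ s)%:E * hausdorff_measure s A.
Proof.
move=> k0 fk; apply: hausdorff_measure_leP => d d0.
have dk0 : (0 < d / k)%R by rewrite divr_gt0.
have ks0 : (0 < k ^+ s)%R by rewrite exprn_gt0.
apply: le_trans (lee_wpmul2l _ (hausdorff_measure_ge s A dk0)); last first.
  by rewrite lee_fin ltW.
rewrite muleC -lee_pdivrMr//; apply: le_ereal_inf_tmp => _ [U [AU dU] <-].
rewrite lee_pdivrMr// muleC -nneseriesZl; last first.
  by move=> *; exact: hausdorff_weight_ge0.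
pose V i := f @` (U i `&` A).
have diamV i (r : R) : (0 <= r)%R -> diam (U i) <= r%:E -> diam (V i) <= (k * r)%:E.
  move=> r0 dUr; apply/diam_leP; first by rewrite mulr_ge0// ltW.
  move=> _ _ [x [Ux Ax] <-] [y [Uy Ay] <-]; apply: le_trans (fk _ _ Ax Ay) _.
  rewrite ler_pM2l// -lee_fin; apply: le_trans dUr; exact: mdist_le_diam.
apply: le_trans (hausdorff_content_le s (U := V) _ _) _.
- by move=> _ [x Ax <-]; have [i _ Ux] := AU _ Ax; exists i => //; exists x.
- move=> i; have := diamV i _ (ltW dk0) (dU i).
  by rewrite mulrC divfK// gt_eqF.
apply: lee_nneseries => i *; first exact: hausdorff_weight_ge0.
rewrite {1}/hausdorff_weight; case: ifPn => [_|/set0P[_ [x [Ux _] _]]].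
  by rewrite mule_ge0 ?hausdorff_weight_ge0// lee_fin ltW.
rewrite /hausdorff_weight ifF; last by apply/negbTE/set0P; exists x.
rewrite EFin_expe -expeMn lee_expe ?diam_ge0//.
have fin : diam (U i) \is a fin_num.
  by rewrite ge0_fin_numE ?diam_ge0// (le_lt_trans (dU i)) ?ltry.
rewrite -(fineK fin) -EFinM; apply: diamV; first by rewrite fine_ge0 ?diam_ge0.
by rewrite fineK.
Qed.

End lipschitz.

(** * Closed sets are Caratheodory measurable *)

Section metric_outer_measure.
Context {R : realType} (M : metricType R) (mu : {outer_measure set M -> \bar R}).
Local Open Scope ereal_scope.
Hypothesis mu_separated : forall (A B : set M) (e : R), (0 < e)%R ->
  (forall a b, A a -> B b -> (e <= mdist a b)%R) -> mu A + mu B <= mu (A `|` B).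

Section closed_set.
Variables (F A : set M).
Hypothesis closedF : closed F.

Let far k := [set x | A x /\ forall y, F y -> (k.+1%:R^-1 <= mdist x y)%R].
Let shell k := far k.+1 `\` far k.

Let far_mono k l : (k <= l)%N -> far k `<=` far l.
Proof.
move=> kl x [Ax h]; split=> // y /h; apply: le_trans.
by rewrite lef_pV2 ?posrE ?ltr0n// ler_nat ltnS.
Qed.

Let farA k : far k `<=` A. Proof. by move=> x []. Qed.

Let bigcup_far : \bigcup_k far k = A `\` F.
Proof.
apply/seteqP; split=> [x [k _ [Ax h]]|x [Ax Fx]].
  by split=> // Fx; have := h x Fx; rewrite mdistxx leNgt invr_gt0 ltr0n.
have /closed_openC : closed F by [].
rewrite openE => /(_ x Fx); rewrite /interior/= -nbhs_ballE => -[e /= e0 xe].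
have [k ke] : exists k, (k.+1%:R^-1 < e)%R.
  exists (Num.truncn e^-1)%N; rewrite invf_plt ?posrE ?ltr0n//.
  by rewrite truncnS_gt.
exists k => //; split=> // y Fy; rewrite leNgt; apply/negP => xyk.
by apply: (xe y) => //; rewrite ballEmdist/=; exact: lt_trans ke.
Qed.

Let far_shell k : mu (far k) + mu (shell k.+1) <= mu (far k.+2).
Proof.
pose e : R := (k.+1%:R^-1 - k.+2%:R^-1)%R.
apply: le_trans (mu_separated (e := e) _ _) _.
- by rewrite subr_gt0 ltf_pV2 ?posrE ?ltr0n// ltr_nat.
- move=> a b [Aa ha] [[Ab _] nb]; rewrite leNgt; apply/negP => abe.
  apply: nb; split=> // y Fy; rewrite leNgt; apply/negP => byk.
  have := ha _ Fy; rewrite leNgt => /negP; apply.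
  rewrite (le_lt_trans (metric_triangle _ b _))//.
  by rewrite -(subrK k.+2%:R^-1%R (k.+1%:R^-1)%R) ltrD.
- by apply: le_outer_measure => x [/(far_mono (leqW (leqnSn k)))//|[]].
Qed.

Let sum_shell b m :
  \sum_(0 <= i < m) mu (shell (b + i.*2.+1)) <= mu (far (b + m.*2)).
Proof.
elim: m => [|m IHm]; first by rewrite big_geq// outer_measure_ge0.
rewrite big_nat_recr//=; apply: le_trans (leeD IHm (lexx _)) _.
by rewrite addnS doubleS !addnS; exact: far_shell.
Qed.

Let sum_shell_le m : \sum_(0 <= k < m.*2.+1) mu (shell k) <=
  mu A + (mu A + mu A).
Proof.
have -> : \sum_(0 <= k < m.*2.+1) mu (shell k) = mu (shell 0) +
   (\sum_(0 <= i < m) mu (shell (0 + i.*2.+1)) +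
    \sum_(0 <= i < m) mu (shell (1 + i.*2.+1))).
  elim: m => [|m IHm]; first by rewrite big_nat1 !big_geq// !adde0.
  rewrite doubleS big_nat_recr//= big_nat_recr//= IHm !big_nat_recr//= add1n add0n.
  by rewrite -!addeA; congr (_ + (_ + _)); rewrite addeCA.
rewrite !leeD//; first by apply: le_outer_measure => x [[]].
- by apply: le_trans (sum_shell _ _) _; apply: le_outer_measure; exact: farA.
- by apply: le_trans (sum_shell _ _) _; apply: le_outer_measure; exact: farA.
Qed.

Let far_tail k : A `\` F `<=` far k `|` \bigcup_(j in ~` `I_k) shell j.
Proof.
move=> x; rewrite -bigcup_far => -[l _].
elim: l => [|l IHl] xl.
  by left; apply: far_mono xl.
have [/IHl//|xNl] := pselect (far l x).
have [kl|lk] := leqP k l.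
  by right; exists l => //=; apply/negP; rewrite -leqNgt.
by left; apply: far_mono xl.
Qed.

Lemma metric_outer_measure_split : mu (A `&` F) + mu (A `&` ~` F) <= mu A.
Proof.
have [->|Aoo] := eqVneq (mu A) +oo; first by rewrite leey.
have Afin : mu A \is a fin_num by rewrite ge0_fin_numE ?outer_measure_ge0// ltey.
have shell0 k : 0 <= mu (shell k) by exact: outer_measure_ge0.
have sumfin : \sum_(0 <= k <oo) mu (shell k) < +oo.
  apply: (@le_lt_trans _ _ (mu A + (mu A + mu A))).
    apply: lime_le; first exact: is_cvg_nneseries.
    near=> n; apply: le_trans (sum_shell_le n).
    apply: lee_sum_nneg_natr => //.
    by rewrite -addnn ltnW// ltnS leq_addr.
  by rewrite -(fineK Afin) -!EFinD ltry.
have tail0 := nneseries_tail_cvg sumfin (fun k _ => shell0 k).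
apply: (@le_trans _ _ (mu A + 0)); last by rewrite adde0.
have cvgA : mu A + \sum_(k <= j <oo) mu (shell j) @[k --> \oo] --> mu A + 0.
  by apply: cvgeD => //; [exact: fin_num_adde_defr|exact: cvg_cst].
rewrite -(cvg_lim _ cvgA)//; apply: lime_ge; first by apply/cvg_ex; exists (mu A + 0).
near=> k; rewrite -setDE.
apply: le_trans (leeD (lexx _) (le_outer_measure mu _ _ (@far_tail k))) _.
apply: le_trans (leeD (lexx _) (outer_measureU2 mu _ _)) _.
rewrite addeA leeD ?outer_measure_sigma_subadditive_tail//.
apply: le_trans (mu_separated (e := k.+1%:R^-1%R) _ _) _.
- by rewrite invr_gt0 ltr0n.
- by move=> a b [_ Fa] [_ hb]; rewrite metric_sym; exact: hb.
- by apply: le_outer_measure => x [[]|[]].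
Unshelve. all: by end_near. Qed.

End closed_set.

(** Caratheodory's criterion.  The part of a set [A] of finite measure that lies
    off [F] is cut into shells, according to the distance to [F].  Shells of the
    same parity are at positive distance from each other, hence the measures of
    the shells are summable and those close to [F] contribute a vanishing
    amount.  The rest of [A] off [F] is at positive distance from [F]. *)
Lemma closed_caratheodory (F : set M) : closed F -> mu.-caratheodory F.
Proof.
move=> cF; apply: le_caratheodory_measurable => A.
exact: metric_outer_measure_split.
Qed.

End metric_outer_measure.

(** * Norms on finite-dimensional space *)

Section norm_facts.
Context {R : realType} {n : nat}.
Implicit Types (N : norm R n) (x y : 'rV[R]_n).

Lemma norm0 N : N 0 = 0.
Proof. by rewrite -(scale0r 0) norm_homogeneous normr0 mul0r. Qed.

Lemma normN N x : N (- x) = N x.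
Proof. by rewrite -scaleN1r norm_homogeneous normrN normr1 mul1r. Qed.

Lemma norm_distC N x y : N (x - y) = N (y - x).
Proof. by rewrite -opprB normN. Qed.

Lemma norm_ge0 N x : 0 <= N x.
Proof.
have := norm_triangle N x (- x); rewrite subrr norm0 normN -mulr2n.
by rewrite pmulrn_lge0.
Qed.

Lemma norm_gt0 N x : x != 0 -> 0 < N x.
Proof.
move=> x0; rewrite lt_def norm_ge0 andbT; apply: contra x0 => /eqP.
by move/norm_definite ->.
Qed.

Lemma entry_le_mx_norm x i : `|x 0 i| <= `|x|.
Proof.
rewrite [leRHS]/Num.norm/= mx_normrE.
by apply/bigmax_geP; right => /=; exists (0, i).
Qed.

Lemma mx_norm_leP x (e : R) : 0 <= e ->
  (`|x| <= e <-> forall i, `|x 0 i| <= e).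
Proof.
move=> e0; split=> [xe i|h]; first exact: le_trans (entry_le_mx_norm x i) xe.
rewrite [leLHS]/Num.norm/= mx_normrE; apply/bigmax_leP; split=> // -[i j] _ /=.
by rewrite ord1.
Qed.

Lemma norm_sum N (I : Type) (r : seq I) (F : I -> 'rV[R]_n) :
  N (\sum_(i <- r) F i) <= \sum_(i <- r) N (F i).
Proof.
elim: r => [|i r IHr]; first by rewrite !big_nil norm0.
by rewrite !big_cons (le_trans (norm_triangle _ _ _))// lerD2l.
Qed.

Lemma norm_upper N : exists2 K, 0 < K & forall x, N x <= K * `|x|.
Proof.
exists (1 + \sum_(i < n) N (delta_mx 0 i)).
  by rewrite ltr_pwDl// sumr_ge0// => i _; exact: norm_ge0.
move=> x; rewrite {1}[x]row_sum_delta; apply: le_trans (norm_sum _ _ _) _.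
rewrite mulrDl mul1r mulr_suml ler_wpDl ?normr_ge0// ler_sum// => i _.
by rewrite norm_homogeneous mulrC ler_wpM2l ?norm_ge0// entry_le_mx_norm.
Qed.

Lemma fun_norm_continuous N : continuous (N : 'rV[R]_n -> R).
Proof.
have [K K0 NK] := norm_upper N.
move=> x; apply: (@cvgrPdist_le _ _ _ (nbhs x) (nbhs_filter x) N (N x)).2 => e e0.
near=> y.
have lip u v : N u - N v <= K * `|u - v|.
  rewrite lerBlDr (le_trans _ (lerD (NK _) (lexx _)))//.
  by rewrite (le_trans _ (norm_triangle _ _ _))// subrK.
have : K * `|x - y| <= e.
  rewrite mulrC -ler_pdivlMr//; near: y.
  have /= := @nbhsx_ballx _ _ x (e / K) (divr_gt0 e0 K0).
  by apply: filterS => y; rewrite -ball_normE/= => /ltW.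
apply: le_trans; rewrite ler_norml lerNl opprB lip andbT distrC; exact: lip.
Unshelve. all: by end_near. Qed.

(** On the compact unit sphere of the sup norm, the continuous function [N]
    stays away from 0. *)
Lemma norm_lower N : exists2 K, 0 < K & forall x, `|x| <= K * N x.
Proof.
pose S := [set x : 'rV[R]_n | `|x| = 1].
have cS : compact S.
  apply: bounded_closed_compact.
    by exists 1; split=> // M M1 x /= ->; exact: ltW.
  rewrite (_ : S = (Num.Def.normr : 'rV[R]_n -> R) @^-1` [set 1])//.
  by apply: closed_comp => [x _|]; [exact: norm_continuous|exact: closed_eq].
have : \forall e \near 0^'+, S `<=` [set x | e < N x].
  apply: (compact_near_coveringP S).1 => // x Sx.
  have Nx0 : 0 < N x.
    apply: norm_gt0; apply/eqP => x0; move: Sx; rewrite x0 /S/= normr0 => /eqP.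
    by rewrite eq_sym oner_eq0.
  near=> y e => /=; apply: (@lt_trans _ _ (N x / 2)).
    near: e; apply: nbhs_right_lt; exact: divr_gt0.
  near: y; apply: (cvgr_gt (N x)); first exact: fun_norm_continuous.
  by rewrite ltr_pdivrMr// ltr_pMr// ltr1n.
move=> near_e; have [e e0 Se] : exists2 e, 0 < e & forall x, S x -> e < N x.
  near (0 : R)^'+ => e; exists e => //.
  by move=> x; exact: (near near_e e).
exists e^-1; first by rewrite invr_gt0.
move=> x; have [->|x0] := eqVneq x 0; first by rewrite normr0 norm0 mulr0.
have x0' : 0 < `|x| by rewrite normr_gt0.
have /Se : S (`|x|^-1 *: x).
  by rewrite /S/= normrZ normrV ?unitfE ?gt_eqF// normr_id mulVf// gt_eqF.
rewrite norm_homogeneous normrV ?unitfE ?gt_eqF// normr_id => /ltW.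
by rewrite mulrC ler_pdivlMr// => h; rewrite mulrC ler_pdivlMr// mulrC.
Unshelve. all: by end_near. Qed.

End norm_facts.

Section normed_space_facts.
Context {R : realType} {n : nat} (N : norm R n).

Lemma mdist_normed_space (x y : normed_space N) :
  mdist x y = N ((x : 'rV[R]_n) - y).
Proof. by []. Qed.

Lemma closed_normed_space (F : set 'rV[R]_n) :
  closed F -> closed (F : set (normed_space N)).
Proof.
have [K K0 NK] := norm_lower N.
move=> cF; rewrite -openC openE => x /= Fx.
have : open (~` F) by rewrite openC.
rewrite openE => /(_ x Fx); rewrite /interior/= => /nbhs_normP[e /= e0 xe].
rewrite -nbhs_ballE; exists (e / K) => /=; first exact: divr_gt0.
move=> y; rewrite ballEmdist/= => xy; apply: xe => /=.
rewrite (le_lt_trans (NK _))// mulrC -ltr_pdivlMr//.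
Qed.

End normed_space_facts.

(** * Finite and countable families of sets *)

Section finite_countable.
Context {R : realType} {T : Type}.
Local Open Scope ereal_scope.

Lemma nneseries_finite (N : nat) (u : nat -> \bar R) :
    (forall k, 0 <= u k) -> (forall k, (N <= k)%N -> u k = 0) ->
  \sum_(0 <= k <oo) u k = \sum_(0 <= k < N) u k.
Proof.
move=> u0 uN; rewrite (nneseries_split 0 N)//.
by rewrite add0n [X in _ + X]eseries0 ?adde0// => k Nk _; exact: uN.
Qed.

Lemma sigma_subadditive_finite (f : set T -> \bar R) (I : finType) (F : I -> set T) :
    f set0 = 0 -> (forall A, 0 <= f A) -> sigma_subadditive f ->
  f (\bigcup_i F i) <= \sum_(i : I) f (F i).
Proof.
move=> f0 fge0 fsub.
pose U k := if insub k is Some j then F (@enum_val I I j) else set0.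
have -> : \bigcup_i F i = \bigcup_k U k.
  apply/seteqP; split=> x [i _]; last first.
    by rewrite /U; case: insubP => //= j _ _; exists (enum_val j).
  move=> Fx; exists (enum_rank i) => //; rewrite /U valK.
  by have := enum_rankK i; rewrite /enum_val => ->.
apply: le_trans (fsub _) _; rewrite (nneseries_finite (N := #|I|))//; last first.
  by move=> k Ik; rewrite /U insubF// ltnNge Ik.
rewrite big_mkord [leRHS](reindex (@enum_val I I))/=; last first.
  exact: onW_bij (enum_val_bij I).
by apply: lee_sum => j _; rewrite /U valK.
Qed.

(** Countable families are turned into sequences by padding with a default
    value. *)
Definition seq_of {I : countType} {V : Type} (d : V) (F : I -> V) (k : nat) : V :=
  oapp F d (pickle_inv k).

Lemma seq_of_pickle {I : countType} {V : Type} (d : V) (F : I -> V) i :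
  seq_of d F (pickle i) = F i.
Proof. by rewrite /seq_of pickleK_inv. Qed.

Lemma bigcup_seq_of {I : countType} (F : I -> set T) :
  \bigcup_k seq_of set0 F k = \bigcup_i F i.
Proof.
apply/seteqP; split=> x [k _].
  by rewrite /seq_of; case: pickle_inv => //= i Fx; exists i.
by move=> Fx; exists (pickle k) => //; rewrite seq_of_pickle.
Qed.

Lemma trivIset_seq_of {I : countType} (F : I -> set T) :
  trivIset setT F -> trivIset setT (seq_of set0 F).
Proof.
move=> tF k l _ _ [x []]; rewrite /seq_of.
have := @pickle_invK I k; have := @pickle_invK I l.
case: pickle_inv => [j|]; case: pickle_inv => [i|] //= <- <- Fi Fj.
by congr pickle; apply: tF => //; exists x.
Qed.

End finite_countable.

Lemma caratheodory_bigcup {R : realType} {T : pointedType}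
    (mu : {outer_measure set T -> \bar R}) (I : countType) (F : I -> set T) :
    (forall i, mu.-caratheodory (F i)) -> trivIset setT F ->
  mu (\bigcup_i F i) = (\sum_(0 <= k <oo) seq_of 0 (mu \o F) k)%E.
Proof.
move=> mF tF; rewrite -bigcup_seq_of.
rewrite (measure_bigcup (mu : {measure set (caratheodory_type mu) -> \bar R})).
- rewrite (eq_eseriesl (Q := xpredT)); last by move=> k; rewrite in_setT.
  apply: eq_eseriesr => k _.
  by rewrite /seq_of; case: pickle_inv => //; exact: outer_measure0.
- move=> k _; rewrite /seq_of; case: pickle_inv => [i|]; first exact: mF.
  exact: caratheodory_measurable_set0.
- exact: trivIset_seq_of.
Qed.

(** * Hausdorff measure on finite-dimensional space *)

(** The same set function as [hausdorff_measure], on the type of row vectors, which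
    unlike [euclidean_space R n] is pointed, as Caratheodory's construction of a
    measure requires. *)
Definition haus {R : realType} {n : nat} (s : nat) (A : set 'rV[R]_n) : \bar R :=
  hausdorff_measure s (A : set (euclidean_space R n)).

Section haus.
Context {R : realType} {n : nat}.
Local Open Scope ereal_scope.
Implicit Types (A B : set 'rV[R]_n) (s : nat).

HB.instance Definition _ s := isOuterMeasure.Build R 'rV[R]_n (@haus R n s)
  (@hausdorff_measure0 R (euclidean_space R n) s)
  (@hausdorff_measure_ge0 R (euclidean_space R n) s)
  (@le_hausdorff_measure R (euclidean_space R n) s)
  (@hausdorff_measure_sigma_subadditive R (euclidean_space R n) s).

Lemma closed_haus_caratheodory s (F : set 'rV[R]_n) :
  closed F -> (haus s).-caratheodory F.
Proof.
move=> cF; apply: (@closed_caratheodory R (euclidean_space R n)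
  (@hausdorff_measure R (euclidean_space R n) s)).
  by move=> A B e e0 h; exact: hausdorff_measure_separated h.
exact: closed_normed_space.
Qed.

Lemma haus_finite_subadditive s (I : finType) (F : I -> set 'rV[R]_n) :
  haus s (\bigcup_i F i) <= \sum_(i : I) haus s (F i).
Proof.
by apply: sigma_subadditive_finite => // A; exact: outer_measure_ge0.
Qed.

Lemma haus_countable_subadditive s (I : countType) (F : I -> set 'rV[R]_n) :
  haus s (\bigcup_i F i) <= \sum_(0 <= k <oo) seq_of 0 (haus s \o F) k.
Proof.
rewrite -bigcup_seq_of; apply: le_trans (outer_measure_sigma_subadditive (haus s) _) _.
rewrite (eq_eseriesr (g := seq_of 0 (haus s \o F)))// => k _.
by rewrite /seq_of; case: pickle_inv => //; exact: outer_measure0.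
Qed.

Lemma haus_lipschitz (m : nat) s (k : R) (f : 'rV[R]_n -> 'rV[R]_m) A :
    (0 < k)%R ->
    (forall x y, A x -> A y -> (l2norm (f x - f y) <= k * l2norm (x - y))%R) ->
  haus s (f @` A) <= (k ^+ s)%:E * haus s A.
Proof.
move=> k0 fk.
by have := @lipschitz_hausdorff_measure R (euclidean_space R n)
  (euclidean_space R m) s k f A k0 fk.
Qed.

Lemma haus_contraction (m : nat) s (f : 'rV[R]_n -> 'rV[R]_m) A :
    (forall x y, A x -> A y -> (l2norm (f x - f y) <= l2norm (x - y))%R) ->
  haus s (f @` A) <= haus s A.
Proof.
move=> fk; have := @haus_lipschitz m s 1 f A ltr01; rewrite expr1n mul1e; apply.
by move=> x y Ax Ay; rewrite mul1r fk.
Qed.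

Lemma image_id_on (f g : 'rV[R]_n -> 'rV[R]_n) A : cancel f g ->
  g @` (f @` A) = A.
Proof.
move=> fK; rewrite image_comp (_ : g \o f = id) ?image_id//.
by apply/funext => x /=; rewrite fK.
Qed.

Lemma haus_translate s (a : 'rV[R]_n) A :
  haus s ((fun x => x + a)%R @` A) = haus s A.
Proof.
apply/eqP; rewrite eq_le haus_contraction/=; last first.
  by move=> x y _ _; rewrite opprD addrACA subrr addr0.
rewrite -{1}(@image_id_on (fun x => x + a)%R (fun x => x - a)%R A); last exact: addrK.
by apply: haus_contraction => x y _ _; rewrite opprD addrACA subrr addr0.
Qed.

Lemma haus_scale s (k : R) A : (0 < k)%R ->
  haus s (( *:%R k) @` A) = (k ^+ s)%:E * haus s A.
Proof.
move=> k0; have ks0 : (0 < k ^+ s)%R by rewrite exprn_gt0.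
apply/eqP; rewrite eq_le; apply/andP; split.
  apply: haus_lipschitz => // x y _ _.
  by rewrite -scalerBr norm_homogeneous gtr0_norm.
rewrite muleC -lee_pdivlMr// muleC -exprVn.
rewrite -{1}(@image_id_on ( *:%R k) ( *:%R k^-1) A); last first.
  by move=> x; rewrite scalerA mulVf ?scale1r// gt_eqF.
apply: haus_lipschitz => [|x y _ _]; first by rewrite invr_gt0.
by rewrite -scalerBr norm_homogeneous gtr0_norm// invr_gt0.
Qed.

End haus.

(** * The Hausdorff measure of cubes *)

Section grid_count.
Context {R : realType}.

(** The numbers that are counted exceed the least of them by at most [2 b]. *)
Lemma card_close_ord (m : nat) (a b : R) : 0 <= b ->
  #|[pred j : 'I_m | `|j%:R - a| < b]|%:R <= 2 * b + 1 :> R.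
Proof.
move=> b0; set A := [pred j | _].
have [j0 j0A|/eq_card0->] := pickP A; last by lra.
have [i iA imin] := arg_minnP (fun j : 'I_m => val j) j0A.
pose k := Num.truncn (2 * b).
have kb : k%:R <= 2 * b by rewrite truncn_le ?mulr_ge0.
have Ak : (#|A| <= k.+1)%N.
  rewrite -[k.+1]card_ord.
  have jk j : j \in A -> (j - i < k.+1)%N.
    move=> jA; have ij := imin _ jA; rewrite ltnS.
    rewrite /k truncn_ge_nat ?mulr_ge0// natrB//.
    move: iA jA; rewrite !inE !ltr_norml => /andP[? ?] /andP[? ?]; lra.
  apply: (@leq_card_in _ _ (fun j : 'I_m => inord (j - i)%N : 'I_k.+1)).
  move=> j1 j2 j1A j2A /(congr1 val); rewrite /= !inordK ?jk// => e.
  apply: val_inj => /=.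
  by rewrite -(subnK (imin _ j1A)) e subnK// imin.
rewrite (@le_trans _ _ k.+1%:R) ?ler_nat// -natr1; lra.
Qed.

(** A ball of radius [r k] contains at most [(3 m r k) ^ n] of the [m ^ n] points of a
    grid of mesh [1 / m] in the cube, if [m] is large. *)
Lemma ball_cover_unit_cube (n N : nat) (P : pred nat) (p : nat -> 'rV[R]_n)
    (r : nat -> R) : (forall k, 0 < r k) ->
    (forall x : 'rV[R]_n, (forall i, 0 <= x 0 i <= 1) ->
      exists k, [/\ (k < N)%N, P k & `|x - p k| < r k]) ->
  1 <= \sum_(k < N | P k) (3 * r k) ^+ n.
Proof.
move=> r0 cover.
have [m m0 mr] : exists2 m, (0 < m)%N & forall k, (k < N)%N -> m%:R^-1 <= r k.
  elim: N {cover} => [|N [m m0 IHm]]; first by exists 1%N.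
  exists (maxn m (Num.truncn (r N)^-1).+1).
    by rewrite leq_max m0.
  have rec k : (r k)^-1 <= (maxn m (Num.truncn (r N)^-1).+1)%:R -> 
    (maxn m (Num.truncn (r N)^-1).+1)%:R^-1 <= r k.
    by rewrite invf_ple ?posrE ?invr_gt0 ?ltr0n ?leq_max ?m0.
  move=> k; rewrite ltnS leq_eqVlt => /orP[/eqP->|kN].
    apply: rec; rewrite (@le_trans _ _ (Num.truncn (r N)^-1).+1%:R)//.
      by rewrite ltW// truncnS_gt.
    by rewrite ler_nat leq_maxr.
  apply: rec; rewrite (@le_trans _ _ m%:R) ?ler_nat ?leq_maxl//.
  by rewrite invf_ple ?posrE ?ltr0n// IHm.
have mR : 0 < m%:R :> R by rewrite ltr0n.
pose G k := [pred g : {ffun 'I_n -> 'I_m} |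
  [forall i, `|(g i)%:R - m%:R * p k 0 i| < m%:R * r k]].
have cG k : (k < N)%N -> #|G k|%:R <= (m%:R * (3 * r k)) ^+ n.
  move=> kN; pose F (i : 'I_n) := [pred j : 'I_m | `|j%:R - m%:R * p k 0 i| < m%:R * r k].
  have -> : #|G k| = (\prod_(i < n) #|F i|)%N.
    transitivity #|family F|; last by rewrite card_family foldrE big_map big_enum.
    by apply: eq_card => g; apply/forallP/familyP.
  rewrite natr_prod -[n in leRHS]card_ord -prodr_const ler_prod// => i _.
  rewrite ler0n andTb.
  apply: le_trans (@card_close_ord m (m%:R * p k 0 i) (m%:R * r k) _) _.
    by rewrite mulr_ge0// ltW.
  have : 1 <= m%:R * r k by rewrite -ler_pdivrMl// mulr1 mr.
  by rewrite [m%:R * (3 * _)]mulrCA; move: (m%:R * r k) => t; lra.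
have : (m ^ n)%:R <= \sum_(k < N | P k) (m%:R * (3 * r k)) ^+ n :> R.
  apply: (@le_trans _ _ (\sum_(k < N | P k) #|G k|)%:R); last first.
    by rewrite natr_sum ler_sum // => k _; exact: cG.
  rewrite ler_nat -[m in (m ^ _)%N]card_ord -[n in (_ ^ n)%N]card_ord -card_ffun.
  rewrite -sum1_card (eq_bigr (fun k : 'I_N => \sum_g (g \in G k : nat)))%N; last first.
    by move=> k _; rewrite -sum1_card big_mkcond.
  rewrite exchange_big/= leq_sum// => g _.
  have [i|k [kN Pk gk]] := cover (\row_i ((g i)%:R / m%:R)).
    by rewrite mxE divr_ge0 ?ler_pdivrMr// mul1r ler_nat ltnW.
  have gG : g \in G k; last by rewrite (bigD1 (Ordinal kN))// [_ \in _]gG.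
  apply/forallP => i; rewrite -[(g i)%:R](mulVKf (lt0r_neq0 mR)) -mulrBr normrM.
  rewrite gtr0_norm// ltr_pM2l//; apply: le_lt_trans gk.
  by apply: le_trans (entry_le_mx_norm _ i); rewrite !mxE mulrC.
rewrite natrX; under eq_bigr do rewrite exprMn.
by rewrite -mulr_sumr ler_pMr// exprn_gt0.
Qed.

End grid_count.

Section unit_cube.
Context {R : realType} {n : nat}.

Lemma exists_exprn_close (a e : R) : 0 <= a -> 0 < e ->
  exists2 r, a < r & r ^+ n <= a ^+ n + e.
Proof.
move=> a0 e0; near a^'+ => r; exists r => //.
rewrite ltW//; near: r; apply: (cvgr_lt (a ^+ n)); last by rewrite ltrDl.
apply: cvg_at_right_filter; exact: exprn_continuous.
Unshelve. all: by end_near. Qed.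

Lemma unit_cube_compact : compact (@unit_cube R n : set 'rV[R]_n).
Proof.
rewrite (_ : @unit_cube R n = [set v : 'rV[R]_n | forall i, `[0, 1]%classic (v ord0 i)]).
  exact: (@rV_compact R n (fun=> `[(0 : R), 1]%classic) (fun=> @segment_compact R 0 1)).
by apply/seteqP; split=> x /= h i; have := h i; rewrite in_itv.
Qed.

(** The sets of a cover are enclosed in open balls whose radii are barely larger
    than their diameters.  By compactness finitely many of these balls cover the
    cube, and [ball_cover_unit_cube] bounds the sum of the powers of their radii
    from below. *)
Lemma haus_unit_cube_gt0 : (0 < haus n (@unit_cube R n : set 'rV[R]_n))%E.
Proof.
have [K K0 NK] := norm_lower (@l2norm R n).
have K3 : 0 < (3 * K) ^+ n by rewrite exprn_gt0// mulr_gt0.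
pose c : R := ((3 * K) ^+ n)^-1 / 2.
have c0 : 0 < c by rewrite divr_gt0 ?invr_gt0.
apply: (@lt_le_trans _ _ c%:E); first by rewrite lte_fin.
apply: le_trans (@hausdorff_measure_ge R (euclidean_space R n) n 1 _ ltr01).
apply: le_ereal_inf_tmp => _ [U [QU dU] <-].
pose d k := fine (diam (U k)).
have dE k : diam (U k) = (d k)%:E.
  by rewrite /d fineK// ge0_fin_numE ?diam_ge0// (le_lt_trans (dU k)) ?ltry.
have d0 k : 0 <= d k by rewrite -lee_fin -dE diam_ge0.
(* Errors of sum at most one half of the lower bound [1 / 3 ^ n] to come. *)
pose e k : R := (3 ^+ n)^-1 / 2 / (2 ^ k.+1)%:R.
have e0 k : 0 < e k by rewrite !divr_gt0// ?invr_gt0 ?exprn_gt0.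
have /choice[r r_spec] k : exists r, K * d k < r /\ r ^+ n <= (K * d k) ^+ n + e k.
  have [|r ? ?] := @exists_exprn_close (K * d k) (e k) _ (e0 k); last by exists r.
  by rewrite mulr_ge0// ltW.
have r0 k : 0 < r k by apply: le_lt_trans (r_spec k).1; rewrite mulr_ge0// ltW.
have /choice[p p_spec] k : exists p : 'rV[R]_n, U k != set0 -> U k p.
  by have [_|/set0P[p Up]] := eqVneq (U k) set0; [exists 0|exists p].
have covB (x : 'rV[R]_n) : unit_cube x -> exists2 k, U k != set0 & `|x - p k| < r k.
  move=> /QU[k _ Ux]; have Uk0 : U k != set0 by apply/set0P; exists x.
  exists k => //; apply: le_lt_trans (r_spec k).1; apply: le_trans (NK _) _.
  rewrite ler_pM2l// -lee_fin -dE; exact: mdist_le_diam Ux (p_spec k Uk0).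
have [N QN] : exists N, forall x : 'rV[R]_n, unit_cube x ->
    exists k, [/\ (k < N)%N, U k != set0 & `|x - p k| < r k].
  have : \forall N \near \oo, (@unit_cube R n : set 'rV[R]_n) `<=`
      [set x | exists k, [/\ (k < N)%N, U k != set0 & `|x - p k| < r k]].
    apply: (compact_near_coveringP _).1 => [|x /covB[k Uk0 xk]].
      exact: unit_cube_compact.
    near=> y N => /=; exists k; split=> //; first by near: N; exact: nbhs_infty_gt.
    near: y; have xk' : 0 < r k - `|x - p k| by rewrite subr_gt0.
    have := @nbhsx_ballx _ _ x _ xk'; apply: filterS => y; rewrite -ball_normE/=.
    rewrite ltrBrDr distrC => h; apply: le_lt_trans h.
    by rewrite -(subrKA x y (- p k)) ler_normD.
  by move=> /filter_ex[N hN]; exists N.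
have := @ball_cover_unit_cube R n N (fun k => U k != set0) p r r0 QN.
have -> : \sum_(k < N | U k != set0) (3 * r k) ^+ n =
    3 ^+ n * \sum_(k < N | U k != set0) r k ^+ n.
  by rewrite mulr_sumr; apply: eq_bigr => k _; rewrite exprMn.
rewrite -ler_pdivrMl ?exprn_gt0// mulr1 => sum_r.
pose w k := hausdorff_weight n (U k).
have w0 k : (0 <= w k)%E by exact: hausdorff_weight_ge0.
have wE k : U k != set0 -> w k = (d k ^+ n)%:E.
  by move=> /negbTE h; rewrite /w /hausdorff_weight h dE EFin_expe.
have sum_rE : (\sum_(k < N | U k != set0) (r k ^+ n)%:E <=
    (K ^+ n)%:E * (\sum_(0 <= k <oo) w k) + ((3 ^+ n)^-1 / 2)%:E)%E.
  apply: (@le_trans _ _ (\sum_(k < N) ((K ^+ n)%:E * w k + (e k)%:E))%E).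
    rewrite big_mkcond/=; apply: lee_sum => k _; case: ifPn => [Uk0|_].
      by rewrite wE// -EFinM -EFinD lee_fin -exprMn (r_spec k).2.
    by rewrite adde_ge0 ?mule_ge0// lee_fin ?exprn_ge0 ?ltW.
  rewrite big_split/= leeD//.
    rewrite -ge0_sume_distrr// lee_pmul2l ?lte_fin ?exprn_gt0//.
    by rewrite -(big_mkord xpredT w); apply: nneseries_lim_ge => k _ _.
  apply: le_trans (epsilon_trick0 xpredT (_ : 0 <= (3 ^+ n)^-1 / 2)); last first.
    by rewrite divr_ge0 ?invr_ge0 ?exprn_ge0.
  rewrite -(big_mkord xpredT (fun k => (e k)%:E)).
  by apply: nneseries_lim_ge => k _ _; rewrite lee_fin ltW.
have {sum_rE} : (((3 ^+ n)^-1)%:E <=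
    (K ^+ n)%:E * (\sum_(0 <= k <oo) w k) + ((3 ^+ n)^-1 / 2)%:E)%E.
  by apply: le_trans sum_rE; rewrite sumEFin lee_fin.
rewrite -leeBlDr// -EFinB {1}[(3 ^+ n)^-1]splitr addrK.
rewrite muleC -lee_pdivrMr ?exprn_gt0// -EFinM; apply: le_trans.
by rewrite lee_fin /c exprMn invfM mulrAC.
Unshelve. all: by end_near. Qed.

End unit_cube.

Section caratheodory_facts.
Context {R : realType} {T : pointedType} (mu : {outer_measure set T -> \bar R}).

Lemma caratheodory_countable_bigcup (I : countType) (F : I -> set T) :
  (forall i, mu.-caratheodory (F i)) -> mu.-caratheodory (\bigcup_i F i).
Proof.
move=> mF; rewrite -bigcup_seq_of; apply: caratheodory_measurable_bigcup => k.
by rewrite /seq_of; case: pickle_inv => //; exact: caratheodory_measurable_set0.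
Qed.

Lemma caratheodory_countable_bigcap (I : countType) (F : I -> set T) :
  (forall i, mu.-caratheodory (F i)) -> mu.-caratheodory (\bigcap_i F i).
Proof.
move=> mF; rewrite -(setCK (\bigcap_i F i)) setC_bigcap.
apply: caratheodory_measurable_setC; apply: caratheodory_countable_bigcup => i.
exact: caratheodory_measurable_setC.
Qed.

End caratheodory_facts.

Section cubes.
Context {R : realType} {n : nat}.
Implicit Types (h : R) (a x : 'rV[R]_n) (p q : 'rV[int]_n).

Definition cube h a : set 'rV[R]_n :=
  [set x | forall i, a 0 i <= x 0 i < a 0 i + h].

Definition lat p : 'rV[R]_n := map_mx intr p.

(** For comparing a volume with that of arbitrarily slight dilations. *)
Lemma lee_scale_limit (c : R) (y : \bar R) : 0 <= c ->
  (forall e, 0 < e -> (y <= ((1 + e) ^+ n * c)%:E)%E) -> (y <= c%:E)%E.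
Proof.
move=> c0 yc; apply/lee_addgt0Pr => d d0.
have c1 : 0 < c + 1 by rewrite ltr_wpDl.
have [r r1 rn] := @exists_exprn_close R n _ _ ler01 (divr_gt0 d0 c1).
have := yc (r - 1); rewrite subr_gt0 => /(_ r1)/le_trans; apply.
rewrite subrKC -EFinD lee_fin; apply: le_trans (ler_wpM2r c0 rn) _.
rewrite expr1n mulrDl mul1r lerD2l mulrAC ler_pdivrMr// ler_pM2l//; lra.
Qed.

Lemma closed_coord_ge (i : 'I_n) (c : R) : closed [set x : 'rV[R]_n | c <= x 0 i].
Proof.
rewrite (_ : [set x | _] = (fun x : 'rV[R]_n => x 0 i) @^-1` [set y | c <= y])//.
by apply: closed_comp; [move=> x _; exact: coord_continuous|exact: closed_ge].
Qed.

Lemma cube_caratheodory s h a : (haus s).-caratheodory (cube h a).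
Proof.
rewrite (_ : cube h a = \bigcap_i ([set x : 'rV[R]_n | a 0 i <= x 0 i] `\`
    [set x : 'rV[R]_n | a 0 i + h <= x 0 i])).
  apply: caratheodory_countable_bigcap => i; apply: caratheodory_measurable_setD.
    by apply: closed_haus_caratheodory; exact: closed_coord_ge.
  by apply: closed_haus_caratheodory; exact: closed_coord_ge.
apply/seteqP; split=> x /= hx i; last first.
  by have [? /negP] := hx i I; rewrite -ltNge => ->; rewrite andbT.
by have /andP[? ?] := hx i; split=> //; apply/negP; rewrite -ltNge.
Qed.

Lemma cubeE h a : 0 < h ->
  cube h a = (fun x => x + a) @` ( *:%R h @` cube 1 0).
Proof.
move=> h0; apply/seteqP; split=> [x xa|_ [_ [x x0 <-] <-] i]; last first.
  have /andP[x1 x2] := x0 i; move: x1 x2; rewrite !mxE add0r => x1 x2.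
  by rewrite lerDr mulr_ge0 ?(ltW h0)//= addrC ltrD2l gtr_pMr.
exists (x - a); last by rewrite subrK.
exists (h^-1 *: (x - a)); last by rewrite scalerA mulfV ?scale1r// gt_eqF.
move=> i; have /andP[x1 x2] := xa i; rewrite !mxE add0r.
by rewrite mulr_ge0 ?invr_ge0 ?subr_ge0 ?(ltW h0)//= mulrC ltr_pdivrMr// mul1r ltrBlDl.
Qed.

Lemma cube_dist h a x y : 0 <= h -> cube h a x -> cube h a y -> `|x - y| <= h.
Proof.
move=> h0 hx hy; apply/mx_norm_leP => // i; rewrite !mxE ler_norml.
by have /andP[? ?] := hx i; have /andP[? ?] := hy i; lra.
Qed.

Lemma haus_cube_scale s h a : 0 < h ->
  haus s (cube h a) = ((h ^+ s)%:E * haus s (cube 1 0))%E.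
Proof. by move=> h0; rewrite cubeE// haus_translate haus_scale. Qed.

Lemma lat_mem_cube h x : 0 < h -> exists p, cube h (h *: lat p) x.
Proof.
move=> h0; exists (\row_i Num.floor (x 0 i / h)) => i; rewrite !mxE.
have /andP[f1 f2] := floor_itv (x 0 i / h).
rewrite mulrC -ler_pdivlMr// f1/= -[X in _ < _ + X]mul1r -mulrDl.
by rewrite -ltr_pdivrMr//; move: f2; rewrite intrD.
Qed.

Lemma lat_cube_inj h x p q : 0 < h ->
  cube h (h *: lat p) x -> cube h (h *: lat q) x -> p = q.
Proof.
move=> h0 xp xq; apply/rowP => i; have := xp i; have := xq i; rewrite !mxE.
have hD (k : int) : h * k%:~R + h = h * (k + 1)%:~R by rewrite intrD mulrDr mulr1.
rewrite !hD => /andP[q1 q2] /andP[p1 p2].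
have := le_lt_trans q1 p2; have := le_lt_trans p1 q2.
rewrite !ltr_pM2l// !ltr_int !ltzD1 => pq qp.
by apply/le_anti; rewrite pq qp.
Qed.

Lemma subset_unit_cube : cube 1 0 `<=` (unit_cube (n := n) : set 'rV[R]_n).
Proof.
by move=> x hx i; have /andP[] := hx i; rewrite mxE add0r => -> /ltW ->.
Qed.

Lemma unit_cube_subset h : 1 < h -> (unit_cube (n := n) : set 'rV[R]_n) `<=` cube h 0.
Proof.
move=> h1 x hx i; have /andP[x0 x1] := hx i.
by rewrite mxE add0r x0/= (le_lt_trans x1).
Qed.

Lemma hausdorff_content_single (M : metricType R) s (d : R) (A : set M) :
  (0 < d)%R -> (diam A <= d%:E)%E ->
  (hausdorff_content s d A <= hausdorff_weight s A)%E.
Proof.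
move=> d0 dA; pose U k := if k is 0%N then A else set0.
apply: le_trans (@hausdorff_content_le _ _ s d A U _ _) _.
- by move=> x Ax; exists 0%N.
- by move=> [//|k]; apply/diam_leP => //; exact: ltW.
rewrite (nneseries_finite (N := 1)); last 2 first.
- by move=> k; exact: hausdorff_weight_ge0.
- by move=> [//|k] _; exact: hausdorff_weight0.
by rewrite big_nat1.
Qed.

(** Subdividing the cube [m] times in each direction gives [m ^ n] pieces of
    diameter at most [K / m], hence of total weight at most [K ^ n]. *)
Lemma haus_cube_fin : (haus n (cube 1 (0 : 'rV[R]_n)) < +oo)%E.
Proof.
have [K K0 NK] := norm_upper (@l2norm R n).
apply: (@le_lt_trans _ _ (K ^+ n)%:E); last exact: ltry.
apply: hausdorff_measure_leP => d d0.
pose m := (Num.truncn (K / d)).+1.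
have m0 : 0 < m%:R :> R by rewrite ltr0n.
have Km : K / m%:R <= d.
  by rewrite ler_pdivrMr// mulrC -ler_pdivrMr// ltW// truncnS_gt.
pose E := euclidean_space R n.
pose a (g : {ffun 'I_n -> 'I_m}) : 'rV[R]_n := m%:R^-1 *: \row_i (g i)%:R.
pose F g : set E := cube m%:R^-1 (a g).
have sub : (cube 1 (0 : 'rV[R]_n) : set E) `<=` \bigcup_g F g.
  have m1 : 0 < m%:R^-1 :> R by rewrite invr_gt0.
  move=> x x01; have [p px] := lat_mem_cube (x : 'rV[R]_n) m1.
  have p_ge0 i : (0 <= p 0 i < m%:Z)%R.
    have /andP[x0 x1] := x01 i; have /andP[p0 p1] := px i; move: x0 x1 p0 p1.
    rewrite !mxE add0r => x0 x1 p0 p1; apply/andP; split.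
      have := le_lt_trans x0 p1.
      rewrite -[X in _ < _ + X]mulr1 -mulrDr pmulr_rgt0 ?invr_gt0//.
      by rewrite -(intrD _ _ 1) ltr0z ltzD1.
    have := le_lt_trans p0 x1; rewrite mulrC ltr_pdivrMr// mul1r.
    by rewrite -[m%:R]/(m%:Z%:~R) ltr_int.
  have pm i : (absz (p 0%R i) < m)%N.
    by have /andP[p0 pm] := p_ge0 i; rewrite -ltz_nat gez0_abs.
  exists [ffun i => Ordinal (pm i)] => // i; have := px i; rewrite !mxE ffunE/=.
  by have /andP[p0 _] := p_ge0 i; rewrite natr_absz ger0_norm.
apply: le_trans (le_hausdorff_content n (lexx d) sub) _.
apply: le_trans (sigma_subadditive_finite _ _ _ _) _.
- exact: hausdorff_content0.
- by move=> A; exact: hausdorff_content_ge0.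
- exact: hausdorff_content_sigma_subadditive.
have dF g : (diam (F g) <= (K / m%:R)%:E)%E.
  apply/diam_leP; first by rewrite divr_ge0// ltW.
  move=> x y Fx Fy; rewrite mdist_normed_space; apply: le_trans (NK _) _.
  by rewrite ler_pM2l//; apply: cube_dist Fx Fy; rewrite invr_ge0 ltW.
apply: (@le_trans _ _ (\sum_(g : {ffun 'I_n -> 'I_m}) ((K / m%:R) ^+ n)%:E)%E).
  apply: lee_sum => g _; apply: le_trans (hausdorff_content_single n d0 _) _.
    by apply: le_trans (dF g) _; rewrite lee_fin.
  rewrite /hausdorff_weight; case: ifP => _.
    by rewrite lee_fin exprn_ge0// divr_ge0// ltW.
  by rewrite EFin_expe; apply: lee_expe; [exact: diam_ge0|exact: dF].
rewrite sumEFin sumr_const card_ffun !card_ord lee_fin -[leLHS]mulr_natl natrX -exprMn.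
by rewrite mulrCA mulfV ?mulr1// gt_eqF.
Qed.

(** The half-open cubes tile the space, whereas volumes are normalized by the
    closed unit cube; the latter lies in half-open cubes of side barely more
    than 1. *)
Lemma haus_unit_cubeE :
  haus n (unit_cube (n := n) : set 'rV[R]_n) = haus n (cube 1 (0 : 'rV[R]_n)).
Proof.
apply/eqP; rewrite eq_le andbC; apply/andP; split.
  exact/le_outer_measure/subset_unit_cube.
rewrite -(fineK (_ : haus n (cube 1 (0 : 'rV[R]_n)) \is a fin_num)); last first.
  by rewrite ge0_fin_numE ?haus_cube_fin// outer_measure_ge0.
apply: lee_scale_limit => [|e e0]; first by rewrite fine_ge0// outer_measure_ge0.
rewrite EFinM fineK; last first.
  by rewrite ge0_fin_numE ?haus_cube_fin// outer_measure_ge0.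
rewrite -(haus_cube_scale n (0 : 'rV[R]_n)); last by rewrite ltr_pwDl// ltW.
by apply: le_outer_measure; apply: unit_cube_subset; rewrite ltrDl.
Qed.

(** The normalizing constant of [vol]. *)
Definition hconst : R := fine (haus n (unit_cube (n := n) : set 'rV[R]_n)).

Lemma hconstE : haus n (unit_cube (n := n) : set 'rV[R]_n) = hconst%:E.
Proof.
rewrite /hconst fineK// haus_unit_cubeE ge0_fin_numE ?haus_cube_fin//.
exact: outer_measure_ge0.
Qed.

Lemma hconst_gt0 : 0 < hconst.
Proof. by rewrite -lte_fin -hconstE haus_unit_cube_gt0. Qed.

Lemma haus_cube h a : 0 < h -> haus n (cube h a) = (h ^+ n * hconst)%:E.
Proof. by move=> h0; rewrite haus_cube_scale// -haus_unit_cubeE hconstE. Qed.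

End cubes.

Arguments hconst {R} n.

(** * The volume of a convex body outside a translate of itself *)

Section cylinder.
Context {R : realType} {k : nat}.

Definition tail_rv (x : 'rV[R]_k.+1) : 'rV[R]_k := \row_j x 0 (lift ord0 j).

Definition cons_rv (t : R) (y : 'rV[R]_k) : 'rV[R]_k.+1 :=
  \row_i oapp (fun j => y 0 j) t (unlift ord0 i).

Lemma cons_rv0 t y : cons_rv t y 0 ord0 = t.
Proof. by rewrite mxE unlift_none. Qed.

Lemma cons_rvS t y j : cons_rv t y 0 (lift ord0 j) = y 0 j.
Proof. by rewrite mxE liftK. Qed.

Lemma tail_rv_cons t y : tail_rv (cons_rv t y) = y.
Proof. by apply/rowP => j; rewrite mxE cons_rvS. Qed.

Lemma tail_rvB x y : tail_rv (x - y) = tail_rv x - tail_rv y.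
Proof. by apply/rowP => j; rewrite !mxE. Qed.

Definition segment_closed {n} (K : set 'rV[R]_n) := forall x y (l : R),
  K x -> K y -> 0 <= l <= 1 -> K (l *: x + (1 - l) *: y).

Definition cylinder (t : R) (P : set 'rV[R]_k) : set 'rV[R]_k.+1 :=
  [set x | P (tail_rv x) /\ 0 <= x 0 ord0 < t].

(** The point [x] is [y] plus a multiple by [e] of a point of the ball of radius [r],
    both of which lie in [P]. *)
Lemma convex_fatten (P : set 'rV[R]_k) (r e : R) (x y : 'rV[R]_k) :
    segment_closed P -> (forall y, l2norm y <= r -> P y) -> 0 < e ->
    P y -> l2norm (x - y) <= e * r ->
  ( *:%R (1 + e) @` P) x.
Proof.
move=> cP Pr e0 Py xy; have e1 : 0 < 1 + e by rewrite ltr_pwDl// ltW.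
exists ((1 + e)^-1 *: x); last by rewrite scalerA mulfV ?scale1r// gt_eqF.
have -> : (1 + e)^-1 *: x =
    (1 + e)^-1 *: y + (1 - (1 + e)^-1) *: (e^-1 *: (x - y)).
  have -> : 1 - (1 + e)^-1 = e / (1 + e) by field; rewrite gt_eqF.
  by rewrite scalerA mulrAC mulfV ?gt_eqF// mul1r scalerBr subrKC.
apply: cP => //.
  by apply: Pr; rewrite norm_homogeneous gtr0_norm ?invr_gt0// ler_pdivrMl.
by rewrite invr_ge0 (ltW e1)/= invf_le1// lerDl ltW.
Qed.

(** Both sides are compared with the number of small cubes that meet [P]: the
    cylinder is covered by the columns over these cubes, whereas the disjoint
    cubes themselves lie in a slight dilation of [P]. *)
Lemma haus_cylinder_le (t r : R) (P : set 'rV[R]_k) : 0 < t -> 0 < r ->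
    segment_closed P -> (forall y, l2norm y <= r -> P y) ->
  (haus k.+1 (cylinder t P) <=
   (t * hconst k.+1 / hconst k)%:E * haus k P)%E.
Proof.
move=> t0 r0 cP Pr; pose c := t * hconst k.+1 / hconst k.
have c0 : 0 < c by rewrite divr_gt0 ?mulr_gt0 ?hconst_gt0.
have [Poo|Pfin] := eqVneq (haus k P) +oo%E.
  by rewrite Poo gt0_muley ?leey// lte_fin.
have {}Pfin : haus k P \is a fin_num.
  by rewrite ge0_fin_numE ?outer_measure_ge0// ltey.
rewrite -(fineK Pfin) -EFinM; apply: (@lee_scale_limit _ k) => [|e e0].
  by rewrite mulr_ge0 ?fine_ge0 ?outer_measure_ge0// ltW.
have e1 : 0 < 1 + e by rewrite ltr_pwDl// ltW.
rewrite mulrCA EFinM [X in (_ <= _ * X)%E]EFinM fineK// -haus_scale//.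
have [K K0 NK] := norm_upper (@l2norm R k).
(* Cubes of side [h = t / m], so that the columns of height [t] consist of [m]
   cubes each, and of diameter at most [e * r], as needed by [convex_fatten]. *)
pose m := (Num.truncn (t * K / (e * r))).+1; pose h := t / m%:R.
have m0 : 0 < m%:R :> R by rewrite ltr0n.
have h0 : 0 < h by rewrite divr_gt0.
have Kh : K * h <= e * r.
  rewrite /h mulrA ler_pdivrMr// [K * t]mulrC [e * r * _]mulrC.
  by rewrite -ler_pdivrMr ?mulr_gt0// ltW// truncnS_gt.
pose J (q : 'rV[int]_k) := `[< cube h (h *: lat q) `&` P !=set0 >].
pose D q : set 'rV[R]_k := if J q then cube h (h *: lat q) else set0.
pose C q : set 'rV[R]_k.+1 := cylinder t (D q).
have CD q : (haus k.+1 (C q) <= c%:E * haus k (D q))%E.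
  rewrite /C /D; case: ifP => _; last first.
    rewrite (_ : cylinder _ _ = set0); last by rewrite -subset0 => x [].
    by rewrite !outer_measure0 mule0.
  rewrite haus_cube//.
  apply: (@le_trans _ _
      (\sum_(j < m) haus k.+1 (cube h (cons_rv (h * j%:R) (h *: lat q))))%E).
    apply: le_trans (haus_finite_subadditive _ _).
    apply: le_outer_measure => x [qx /andP[x0 xt]].
    have xh : 0 <= x 0 ord0 / h by rewrite divr_ge0// ltW.
    set y := x 0 ord0 / h in xh; have jm : (Num.truncn y < m)%N.
      rewrite truncn_lt_nat// ltr_pdivrMr// /h mulrC divfK ?gt_eqF//.
    exists (Ordinal jm) => // i; have [j ->|->] := unliftP ord0 i.
      by rewrite cons_rvS; have := qx j; rewrite [tail_rv x _ _]mxE.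
    rewrite cons_rv0/=; have /andP[] := truncn_itv xh; rewrite /y => j1 j2.
    rewrite mulrC -ler_pdivlMr// j1/= -[X in _ < _ + X]mul1r -mulrDl -ltr_pdivrMr//.
    by rewrite natr1.
  under eq_bigr do rewrite haus_cube//.
  rewrite sumEFin sumr_const card_ord -EFinM lee_fin -[leLHS]mulr_natl.
  rewrite le_eqVlt; apply/orP; left; apply/eqP.
  have hm : h * m%:R = t by rewrite /h divfK// gt_eqF.
  by rewrite /c -hm exprS; field; rewrite gt_eqF// hconst_gt0.
apply: (@le_trans _ _ (haus k.+1 (\bigcup_q C q))).
  apply: le_outer_measure => x [Px xt]; have [q qx] := lat_mem_cube (tail_rv x) h0.
  exists q => //; split=> //; rewrite /D ifT//; apply/asboolP.
  by exists (tail_rv x).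
apply: le_trans (haus_countable_subadditive _ _) _.
apply: (@le_trans _ _ (\sum_(0 <= i <oo) c%:E * seq_of 0 (haus k \o D) i)%E).
  apply: lee_nneseries => i; rewrite /seq_of; case: pickle_inv => [q|]//=.
  - by move=> _ _; exact: outer_measure_ge0.
  - by move=> _; rewrite mule0.
rewrite nneseriesZl; last first.
  by move=> i _; rewrite /seq_of; case: pickle_inv => [q|]//=; exact: outer_measure_ge0.
rewrite -caratheodory_bigcup; last 2 first.
- move=> q; rewrite /D; case: ifP => _; first exact: cube_caratheodory.
  exact: caratheodory_measurable_set0.
- move=> q q' _ _ [x []]; rewrite /D; case: ifP => // _ qx; case: ifP => // _.
  exact: lat_cube_inj qx.
rewrite lee_pmul2l ?lte_fin//; apply: le_outer_measure => x [q _].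
rewrite /D; case: ifPn => // /asboolP[y [qy Py]] qx.
apply: (convex_fatten cP Pr e0 Py); apply: le_trans Kh; apply: le_trans (NK _) _.
by rewrite ler_pM2l//; apply: cube_dist qx qy; exact: ltW.
Qed.

End cylinder.

Section pieces.
Context {R : realType} {n : nat}.
Implicit Types (S T K : set 'rV[R]_n).

(** Each piece of [S] keeps its measure when it is translated, and the translates
    find room side by side in [T]. *)
Lemma haus_pieces s (I : countType) (P : I -> set 'rV[R]_n) (v : I -> 'rV[R]_n)
    S T : S `<=` \bigcup_i P i ->
    (forall i, (haus s).-caratheodory [set x | P i (x + v i)]) ->
    trivIset setT (fun i => [set x | P i (x + v i)]) ->
    (forall i x, P i (x + v i) -> T x) ->
  (haus s S <= haus s T)%E.
Proof.
move=> SP mP tP PT.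
apply: (@le_trans _ _ (haus s (\bigcup_i [set x | P i (x + v i)]))); last first.
  by apply: le_outer_measure => x [i _ /= Px]; exact: PT Px.
apply: le_trans (le_outer_measure _ _ _ SP) _.
apply: le_trans (haus_countable_subadditive _ _) _.
rewrite caratheodory_bigcup//; apply: lee_nneseries => k; rewrite /seq_of.
  by case: pickle_inv => [i|]//= *; exact: outer_measure_ge0.
case: pickle_inv => [i _|]//=.
rewrite -(haus_translate s (v i) [set x | P i (x + v i)]).
by apply: le_outer_measure => x Px; exists (x - v i) => /=; rewrite subrK.
Qed.

Lemma lipschitz_continuous {m : nat} (f : 'rV[R]_n -> 'rV[R]_m) (L : R) : 0 < L ->
  (forall x y, `|f x - f y| <= L * `|x - y|) -> continuous f.
Proof.
move=> L0 fL x; apply: (@cvgrPdist_le _ _ _ (nbhs x) (nbhs_filter x) f (f x)).2 => e e0.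
have := @nbhsx_ballx _ _ x (e / L) (divr_gt0 e0 L0); apply: filterS => y.
rewrite -ball_normE/= ltr_pdivlMr// mulrC => /ltW xy; exact: le_trans (fL _ _) xy.
Qed.

Lemma closed_translate K a : closed K -> closed [set x | K (x + a)].
Proof.
move=> cK; rewrite (_ : [set x | _] = (fun x => x + a) @^-1` K)//.
apply: closed_comp => // x _; apply: (lipschitz_continuous ltr01) => u w.
by rewrite mul1r opprD addrACA subrr addr0.
Qed.

End pieces.

Section slabs.
Context {R : realType} {k : nat}.

Let e0 : 'rV[R]_k.+1 := delta_mx 0 ord0.

(** Two points of the left-hand set never differ by a nonzero multiple of
    [t *: e0], since [K] meets every line parallel to [e0] in an interval.  Hence
    its slices between the heights [t j] and [t (j + 1)] remain disjoint when they
    are all translated to height 0. *)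
Lemma haus_slabs_le (t : R) (K : set 'rV[R]_k.+1) : 0 < t ->
    closed K -> segment_closed K ->
  (haus k.+1 [set x | K x /\ ~ K (x - t *: e0)%R] <=
   haus k.+1 (cylinder t (tail_rv @` K)))%E.
Proof.
move=> t0 cK convK; pose v (j : int) : 'rV[R]_k.+1 := (t * j%:~R) *: e0.
pose P (j : int) := [set x : 'rV[R]_k.+1 | (K x /\ ~ K (x - t *: e0)) /\
  t * j%:~R <= x 0 ord0 < t * j%:~R + t].
have v00 (x : 'rV[R]_k.+1) j : (x + v j) 0 ord0 = x 0 ord0 + t * j%:~R.
  by rewrite !mxE eqxx mulr1.
have v0S (x : 'rV[R]_k.+1) j : tail_rv (x + v j) = tail_rv x.
  by apply/rowP => i; rewrite !mxE andbC/= mulr0 addr0.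
have PE j : [set x | P j (x + v j)] = [set x | K (x + v j)] `&`
   ~` [set x | K (x + (v j - t *: e0))] `&`
   ([set x : 'rV[R]_k.+1 | 0 <= x 0 ord0] `\` [set x : 'rV[R]_k.+1 | t <= x 0 ord0]).
  apply/seteqP; split=> x; rewrite /P /= v00 addrA.
    rewrite lerDr [_ + t]addrC ltrD2r => -[[? ?] /andP[x0 xt]]; split=> //; split=> //.
    by apply/negP; rewrite -ltNge.
  move=> [[? ?] [x0 /negP]]; rewrite -ltNge => xt; split=> //.
  by rewrite lerDr [_ + t]addrC ltrD2r x0.
apply: (haus_pieces (P := P) (v := v)).
- move=> x Kx; exists (Num.floor (x 0 ord0 / t)) => //; split=> //.
  have /andP[f1 f2] := floor_itv (x 0 ord0 / t).
  rewrite mulrC -ler_pdivlMr// f1/= -[X in _ < _ + X]mul1r -mulrDl.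
  by rewrite -ltr_pdivrMr//; move: f2; rewrite intrD.
- move=> j; rewrite PE; apply: caratheodory_measurable_setI.
    apply: caratheodory_measurable_setI.
      by apply: closed_haus_caratheodory; exact: closed_translate.
    apply: caratheodory_measurable_setC.
    by apply: closed_haus_caratheodory; exact: closed_translate.
  by apply: caratheodory_measurable_setD; apply: closed_haus_caratheodory;
    exact: closed_coord_ge.
- have lt_false i j x : (i < j)%R -> P i (x + v i) -> P j (x + v j) -> False.
    move=> ij [[Ki _] _] [[Kj Kj'] _]; apply: Kj'.
    have ji0 : 0 < (j - i)%:~R :> R by rewrite ltr0z subr_gt0.
    (* One step back from [x + v j] is still between [x + v i] and [x + v j]. *)
    have -> : x + v j - t *: e0 = (j - i)%:~R^-1 *: (x + v i) +
        (1 - (j - i)%:~R^-1) *: (x + v j).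
      rewrite /v; apply/rowP => l; rewrite !mxE.
      move: (x 0 l) (_%:R : R) => a b; rewrite intrB in ji0 *.
      field; rewrite gt_eqF//.
    apply: convK => //; rewrite invr_ge0 (ltW ji0)/= invf_le1//.
    by rewrite (_ : 1 = 1%:~R)// ler_int -gtz0_ge1 subr_gt0.
  move=> i j _ _ [x [Pi Pj]]; have [|ij] := leP i j; last first.
    by have := lt_false _ _ _ ij Pj Pi.
  by rewrite le_eqVlt => /orP[/eqP//|ij]; have := lt_false _ _ _ ij Pi Pj.
- move=> j x; rewrite -[P j _]/([set x | P j (x + v j)] x) PE => -[[Kx _] [x0 /negP]].
  rewrite -ltNge => xt; split; last by rewrite xt andbT.
  by exists (x + v j) => //; rewrite v0S.
Qed.

End slabs.

Section dot.
Context {R : realType} {n : nat}.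
Implicit Types (x y z u : 'rV[R]_n) (a : R).

Lemma dotC x y : dot x y = dot y x.
Proof. by apply: eq_bigr => i _; rewrite mulrC. Qed.

Lemma dotBl x y z : dot (x - y) z = dot x z - dot y z.
Proof. by rewrite -sumrB; apply: eq_bigr => i _; rewrite !mxE mulrBl. Qed.

Lemma dotZl a x y : dot (a *: x) y = a * dot x y.
Proof. by rewrite mulr_sumr; apply: eq_bigr => i _; rewrite !mxE mulrA. Qed.

Lemma dotBr x y z : dot x (y - z) = dot x y - dot x z.
Proof. by rewrite dotC dotBl !(dotC x). Qed.

Lemma dotZr a x y : dot x (a *: y) = a * dot x y.
Proof. by rewrite dotC dotZl dotC. Qed.

Lemma dot_ge0 x : 0 <= dot x x.
Proof. by apply: sumr_ge0 => i _; rewrite -expr2 sqr_ge0. Qed.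

Lemma l2normE x : l2norm x = Num.sqrt (dot x x).
Proof. by []. Qed.

Lemma sqr_l2norm x : l2norm x ^+ 2 = dot x x.
Proof. by rewrite l2normE sqr_sqrtr ?dot_ge0. Qed.

Lemma dot_eq0 x : (dot x x == 0) = (x == 0).
Proof.
apply/eqP/eqP => [x0|->]; last by rewrite -sqr_l2norm norm0 expr0n.
by apply: (@norm_definite R n l2norm); rewrite l2normE x0 sqrtr0.
Qed.

(** The reflection in the hyperplane orthogonal to [u], which is the identity
    when [u = 0]. *)
Definition reflection u x : 'rV[R]_n := x - (2 * dot x u / dot u u) *: u.

Lemma reflectionB u x y : reflection u (x - y) = reflection u x - reflection u y.
Proof.
rewrite /reflection dotBl mulrBr mulrBl scalerBl.
by rewrite !opprD !opprK addrACA.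
Qed.

Lemma reflectionD u x y : reflection u (x + y) = reflection u x + reflection u y.
Proof. by apply/eqP; rewrite -subr_eq -reflectionB addrK. Qed.

Lemma reflectionZ u a x : reflection u (a *: x) = a *: reflection u x.
Proof. by rewrite /reflection dotZl scalerBr scalerA mulrCA !mulrA. Qed.

Lemma dot_reflection u x y : dot (reflection u x) (reflection u y) = dot x y.
Proof.
rewrite /reflection; have [->|u0] := eqVneq u 0; first by rewrite !scaler0 !subr0.
rewrite !(dotBl, dotBr, dotZl, dotZr) (dotC u y).
by field; rewrite dot_eq0.
Qed.

Lemma reflectionK u : involutive (reflection u).
Proof.
move=> x; rewrite /reflection.
have [->|u0] := eqVneq u 0; first by rewrite !scaler0 !subr0.
set c := 2 * dot x u / dot u u.
have -> : 2 * dot (x - c *: u) u / dot u u = - c.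
  by rewrite dotBl dotZl /c; field; rewrite dot_eq0.
by rewrite scaleNr opprK subrK.
Qed.

Lemma l2norm_reflection u x : l2norm (reflection u x) = l2norm x.
Proof. by rewrite !l2normE dot_reflection. Qed.

End dot.

Section shift.
Context {R : realType} {k : nat}.
Implicit Types (x y z : 'rV[R]_k.+1).

Lemma dot_delta x : dot x (delta_mx 0 ord0) = x 0 ord0.
Proof.
rewrite /dot (bigD1 ord0)//= big1 ?addr0 ?mxE ?eqxx ?mulr1// => i i0.
by rewrite mxE (negbTE i0) andbF mulr0.
Qed.

(** The Householder reflection that takes [z] to the first axis. *)
Lemma householder z : reflection (z - l2norm z *: delta_mx 0 ord0) z =
  l2norm z *: delta_mx 0 ord0.
Proof.
set e := delta_mx 0 ord0; set u := z - _.
have [u0|u0] := eqVneq u 0.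
  by rewrite u0 /reflection scaler0 subr0; apply/eqP; rewrite -subr_eq0 -/u u0.
have ee : dot e e = 1 by rewrite dot_delta mxE eqxx.
have uu : dot u u = 2 * dot z u.
  rewrite /u !(dotBl, dotBr, dotZl, dotZr) ee (dotC e) mulr1 -(sqr_l2norm z); ring.
by rewrite /reflection -uu divff ?dot_eq0// scale1r /u opprB subrKC.
Qed.

Lemma l2norm_cons0 (y : 'rV[R]_k) : l2norm (cons_rv 0 y) = l2norm y.
Proof.
rewrite !l2normE /dot big_ord_recl cons_rv0 mulr0 add0r.
by congr Num.sqrt; apply: eq_bigr => i _; rewrite cons_rvS.
Qed.

Lemma l2norm_tail x : l2norm (tail_rv x) <= l2norm x.
Proof.
rewrite !l2normE ler_wsqrtr// {2}/dot big_ord_recl ler_wpDl -?expr2 ?sqr_ge0//.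
by apply: ler_sum => i _; rewrite mxE.
Qed.

(** A reflection takes [z] to the first axis, where [haus_slabs_le] and
    [haus_cylinder_le] apply.  The base of the resulting cylinder is isometric to
    the projection of [K] along [z]. *)
Lemma haus_shift_le (r : R) (K : set 'rV[R]_k.+1) z : z != 0 -> 0 < r ->
    closed K -> segment_closed K -> (forall x, l2norm x <= r -> K x) ->
  (haus k.+1 [set x | K x /\ ~ K (x - z)%R] <=
   (l2norm z * hconst k.+1 / hconst k)%:E * haus k (proj_orth z @` K))%E.
Proof.
move=> z0 r0 cK sK Kr; have lz0 : 0 < l2norm z by rewrite norm_gt0.
pose e : 'rV[R]_k.+1 := delta_mx 0 ord0.
pose f := reflection (z - l2norm z *: e).
have fz : f (l2norm z *: e) = z.
  by rewrite -[RHS](reflectionK (z - l2norm z *: e)) householder.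
have fB x y : f (x - y) = f x - f y by exact: reflectionB.
have fK : involutive f by exact: reflectionK.
have fl2 x : l2norm (f x) = l2norm x by exact: l2norm_reflection.
pose K' := f @^-1` K.
have cK' : closed K'.
  apply: closed_comp => // x _.
  have [A A0 hA] := norm_lower (@l2norm R k.+1).
  have [B B0 hB] := norm_upper (@l2norm R k.+1).
  apply: (lipschitz_continuous (mulr_gt0 A0 B0)) => u w; apply: le_trans (hA _) _.
  by rewrite -fB fl2 -mulrA ler_pM2l.
have sK' : segment_closed K'.
  by move=> x y l Kx Ky l01; rewrite /K'/= /f reflectionD !reflectionZ; exact: sK.
pose S' := [set x | K' x /\ ~ K' (x - l2norm z *: e)].
have SE : [set x | K x /\ ~ K (x - z)] = f @` S'.
  apply/seteqP; split=> [x [Kx Kxz]|_ [x [Kx Kxz] <-]].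
    by exists (f x) => //; split; rewrite /K'/= ?fK// fB fK fz.
  by split=> //; move: Kxz; rewrite /K'/= fB fz.
rewrite SE; apply: le_trans (@haus_contraction R _ _ _ f S' _) _.
  by move=> x y _ _; rewrite -fB fl2.
apply: le_trans (haus_slabs_le lz0 cK' sK') _.
apply: le_trans (@haus_cylinder_le R k (l2norm z) r _ lz0 r0 _ _) _.
- move=> _ _ l [x Kx <-] [y Ky <-] l01; exists (l *: x + (1 - l) *: y); first exact: sK'.
  by apply/rowP => i; rewrite !mxE.
- move=> y yr; exists (cons_rv 0 y); last exact: tail_rv_cons.
  by apply: Kr; rewrite fl2 l2norm_cons0.
rewrite lee_pmul2l ?lte_fin ?divr_gt0 ?mulr_gt0 ?hconst_gt0//.
apply: (@le_trans _ _ (haus k ((@tail_rv R k \o f) @` (proj_orth z @` K)))); last first.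
  apply: haus_contraction => x y _ _ /=.
  by rewrite -tail_rvB -fB (le_trans (l2norm_tail _))// fl2.
apply: le_outer_measure => _ [x Kx <-]; exists (proj_orth z (f x)); first by exists (f x).
rewrite /= /proj_orth fB fK -[in f (_ *: z)]fz /f -!reflectionZ -/f fK.
by apply/rowP => i; rewrite !mxE andbC/= !mulr0 subr0.
Qed.

End shift.

(** * Uniformly random orders *)

Lemma mnormalizeE d (T : measurableType d) {R : realType}
    (mu : {measure set T -> \bar R}) (P : probability T R) (c : R) (A : set T) :
  0 < c -> mu setT = c%:E -> mnormalize mu P A = (mu A * (c^-1)%:E)%E.
Proof.
by move=> c0 muT; rewrite /mnormalize muT ifF// orbF eqe gt_eqF.
Qed.

Section random_order.
Context {R : realType} (I : finType).

(* A permutation is read as an order by means of an enumeration of [I]. *)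
Let ranking (s : {perm I}) (i : I) : nat := enum_rank (s i).

Let ranking_inj s : injective (ranking s).
Proof. by move=> i j /val_inj/enum_rank_inj/perm_inj. Qed.

Let first (W : {set I}) (i : I) : pred {perm I} :=
  fun s => [forall (w | w \in W), (ranking s i <= ranking s w)%N].

(** Exchanging the ranks of two elements of [W] shows that all of them are
    equally likely to be the first one. *)
Let card_first (W : {set I}) (i : I) : i \in W ->
  (#|first W i| * #|W| <= #|{perm I}|)%N.
Proof.
move=> iW.
have le_first w : w \in W -> (#|first W i| <= #|first W w|)%N.
  move=> wW; rewrite -(fintype.card_image (@mulgI _ (tperm i w)) (first W i)).
  apply: subset_leq_card; apply/fintype.subsetP => _ /mapP[s + ->]; rewrite mem_enum => si.
  apply/forall_inP => v vW; move/forall_inP: si => si.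
  by rewrite /ranking !permM tpermR; case: tpermP => *; exact: si.
apply: (@leq_trans (\sum_(w in W) #|first W w|)).
  by rewrite mulnC -sum_nat_const; apply: leq_sum.
rewrite -sum1_card; under eq_bigr do rewrite -sum1_card big_mkcond.
rewrite exchange_big/=; apply: leq_sum => s _.
have [w wW /= wmin] := arg_minnP (ranking s) iW.
rewrite -big_mkcondr/= (eq_bigl (pred1 w)) ?big_pred1_eq// => v.
apply/andP/eqP => [[vW /forall_inP vmin]|->].
  by apply: (@ranking_inj s); apply/eqP; rewrite eqn_leq wmin// vmin.
by split=> //; apply/forall_inP.
Qed.

(** The order is indexed by natural numbers, on which all sets are events. *)
Lemma exists_random_order : exists (Q : probability nat R) (rk : nat -> I -> nat),
  (forall j, injective (rk j)) /\
  (forall (W : {set I}) i, i \in W ->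
   (Q [set j | forall w, w \in W -> (rk j i <= rk j w)%N] <= (#|W|%:R^-1)%:E)%E).
Proof.
pose N := #|{perm I}|.
have N0 : (0 < N)%N by apply/card_gt0P; exists 1%g.
pose mu : {measure set nat -> \bar R} :=
  msum (fun j : nat => \d_j : {measure set nat -> \bar R}) N.
pose s j := nth 1%g (enum {perm I}) j.
have muE (A : set nat) : mu A = (\sum_(j < N) \1_A (j : nat))%:E.
  by rewrite -sumEFin; apply: eq_bigr => j _; exact: diracE.
have muT : mu setT = N%:R%:E.
  rewrite muE (eq_bigr (fun=> 1)) => [|j _]; last by rewrite indicE in_setT.
  by rewrite sumr_const card_ord.
have N0' : 0 < N%:R :> R by rewrite ltr0n.
exists (mnormalize mu (\d_0%N : probability nat R)), (fun j => ranking (s j)).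
split=> [j|W i iW]; first exact: ranking_inj.
have QE A := mnormalizeE (\d_0%N : probability nat R) A N0' muT.
rewrite [X in (X <= _)%E]QE muE -EFinM lee_fin ler_pdivrMr ?ltr0n//=.
have W0 : (0 < #|W|)%N by apply/card_gt0P; exists i.
rewrite mulrC ler_pdivlMr ?ltr0n//.
apply: (@le_trans _ _ (#|first W i| * #|W|)%:R); last by rewrite ler_nat card_first.
rewrite natrM ler_pM2r ?ltr0n// -sum1_card.
rewrite natr_sum (reindex (@enum_val _ {perm I}))/=; last first.
  exact: onW_bij (enum_val_bij _).
rewrite [leRHS]big_mkcond/=; apply: ler_sum => j _.
rewrite (enum_val_nth 1%g) -/(s j) indicE.
case: ifPn => [_|sj]; first by rewrite lern1 leq_b1.
rewrite lern0 eqb0; apply: contra sj; rewrite inE => sj.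
by apply/forall_inP => w wW; exact: sj.
Qed.

End random_order.

(** * Cells around lattice points *)

Section lattice_classes.
Context {R : realType} {n : nat}.

(** The residue classes of the lattice modulo a large integer. *)
Lemma exists_lattice_classes (N : norm R n) (B : R) :
  exists (I : finType) (cls : 'rV[int]_n -> I), forall p q,
    cls p = cls q -> N (lat p - lat q) <= B -> p = q.
Proof.
have [K K0 NK] := norm_lower N.
pose m := Num.truncn (K * B).
exists {ffun 'I_n -> 'I_m.+1}, (fun p => [ffun i => inord (absz (p 0%R i %% m.+1)%Z)]).
move=> p q /ffunP pq pqB; apply/rowP => i; apply/eqP/contraT => pqi.
have : (p 0%R i %% m.+1)%Z = (q 0%R i %% m.+1)%Z.
  have lt_m (z : int) : (absz (z %% m.+1)%Z < m.+1)%N.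
    by rewrite -ltz_nat gez0_abs ?modz_ge0// ltz_pmod.
  have := pq i; rewrite !ffunE => /(congr1 val); rewrite /= !inordK ?lt_m//.
  by move=> /(congr1 Posz); rewrite !gez0_abs ?modz_ge0.
move/eqP; rewrite eqz_mod_dvd => /dvdzP[c pqc].
have c0 : c != 0 by apply: contra pqi => /eqP c0; rewrite -subr_eq0 pqc c0 mul0r.
have : (m.+1%:R : R) <= K * B.
  apply: le_trans (ler_wpM2l (ltW K0) pqB); apply: le_trans (NK _).
  apply: le_trans (entry_le_mx_norm _ i); rewrite !mxE -intrB pqc.
  rewrite -intr_norm normrM (_ : m.+1%:R = m.+1%:~R)// ler_int.
  by rewrite ler_peMl// -gtz0_ge1 normr_gt0.
by move=> h; have := truncnS_gt (K * B); rewrite ltNge h.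
Qed.

End lattice_classes.

Section cells.
Context {R : realType} {n : nat} (N : norm R n) (rad : R).
Context (I : finType) (cls : 'rV[int]_n -> I) (rk : I -> nat).
Implicit Types (p q : 'rV[int]_n) (x y : 'rV[R]_n).

(** The cluster of the center [lat p] when every point goes to the first ball that
    contains it. *)
Definition cell p : set 'rV[R]_n :=
  [set y | N (y - lat p) <= rad /\
    forall q, (rk (cls q) < rk (cls p))%N -> rad < N (y - lat q)].

Hypothesis rk_inj : injective rk.
(* At most one ball of each class comes within distance 1 of a given point, as
   two balls of radius [rad + 1] that meet have centers at most
   [2 * rad + 2] apart. *)
Hypothesis cls_inj : forall p q,
  cls p = cls q -> N (lat p - lat q) <= 2 * rad + 2 -> p = q.

Lemma dist_centers y p q (r s : R) : N (y - lat p) <= r -> N (y - lat q) <= s ->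
  N (lat p - lat q) <= r + s.
Proof.
move=> yp yq; rewrite -(subrKA y) (le_trans (norm_triangle _ _ _))//.
by rewrite lerD// norm_distC.
Qed.

Lemma exists_first (U : 'rV[int]_n -> Prop) : (exists p, U p) ->
  exists2 p, U p & forall q, U q -> (rk (cls p) <= rk (cls q))%N.
Proof.
move=> [p Up]; have [m] := ubnP (rk (cls p)).
elim: m p Up => // m IHm p Up pm.
have [h|] := pselect (forall q, U q -> (rk (cls p) <= rk (cls q))%N); first by exists p.
move=> /existsNP[q /not_implyP[Uq /negP]]; rewrite -ltnNge => qp.
by apply: (IHm q) => //; exact: leq_trans qp _.
Qed.

Lemma cell_cover y : (exists p, N (y - lat p) <= rad) -> exists p, cell p y.
Proof.
move=> /exists_first[p yp pmin]; exists p; split=> // q qp.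
by rewrite ltNge; apply/negP => /pmin; rewrite leqNgt qp.
Qed.

Lemma cell_inj y p q : 0 < rad -> cell p y -> cell q y -> p = q.
Proof.
move=> rad0 [yp p1] [yq q1]; apply: cls_inj.
  apply: rk_inj; case: (ltngtP (rk (cls p)) (rk (cls q))) => // pq.
    by have := q1 _ pq; rewrite ltNge yp.
  by have := p1 _ pq; rewrite ltNge yq.
by rewrite (le_trans (dist_centers yp yq))//; lra.
Qed.

Lemma cell_diam p x y : cell p x -> cell p y -> N (x - y) <= 2 * rad.
Proof.
move=> [xp _] [yp _]; rewrite -(subrKA (lat p)) (le_trans (norm_triangle _ _ _))//.
by rewrite mulr2n mulrDl mul1r lerD// norm_distC.
Qed.

Definition cell_core p (l : nat) : set 'rV[R]_n :=
  [set y | N (y - lat p) <= rad /\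
    forall q, (rk (cls q) < rk (cls p))%N -> rad + l.+1%:R^-1 <= N (y - lat q)].

(** At most one ball of each of the finitely many classes comes near a given point,
    hence the balls that do not contain it stay at a positive distance. *)
Lemma cell_bigcup p : cell p = \bigcup_l cell_core p l.
Proof.
apply/seteqP; split=> [y [yp p1]|y [l _ [yp p1]]]; last first.
  by split=> // q /p1; apply: lt_le_trans; rewrite ltrDl invr_gt0.
have /choice[l lP] (i : I) : exists l, forall q, cls q = i ->
    rad < N (y - lat q) -> rad + l.+1%:R^-1 <= N (y - lat q).
  have [[q [qi q1 q2]]|none] := pselect (exists q, [/\ cls q = i,
      rad < N (y - lat q) & N (y - lat q) <= rad + 1]).
    exists (Num.truncn (N (y - lat q) - rad)^-1) => q' q'i q'1.
    have [q'2|q'2] := leP (N (y - lat q')) (rad + 1).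
      have -> : q' = q.
        apply: cls_inj; first by rewrite qi.
        by rewrite (le_trans (dist_centers q'2 q2))//; lra.
      rewrite -lerBrDl invf_ple ?posrE ?subr_gt0 ?ltr0n//.
      by rewrite ltW// truncnS_gt.
    by rewrite (le_trans _ (ltW q'2))// lerD2l invf_le1// ler1n.
  exists 0%N => q qi q1; rewrite invr1 leNgt; apply/negP => q2.
  by apply: none; exists q; split=> //; exact: ltW.
exists (\max_i l i)%N => //; split=> // q qp.
apply: le_trans (lP (cls q) q erefl (p1 q qp)).
by rewrite lerD2l lef_pV2 ?posrE ?ltr0n// ler_nat ltnS leq_bigmax.
Qed.

Lemma closed_norm_le (a : 'rV[R]_n) (r : R) : closed [set y | N (y - a) <= r].
Proof.
apply: (@closed_translate _ _ [set y | N y <= r] (- a)).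
rewrite (_ : [set y | _] = N @^-1` [set y | y <= r])//.
by apply: closed_comp; [move=> x _; exact: fun_norm_continuous|exact: closed_le].
Qed.

Lemma closed_norm_ge (a : 'rV[R]_n) (r : R) : closed [set y | r <= N (y - a)].
Proof.
apply: (@closed_translate _ _ [set y | r <= N y] (- a)).
rewrite (_ : [set y | _] = N @^-1` [set y | r <= y])//.
by apply: closed_comp; [move=> x _; exact: fun_norm_continuous|exact: closed_ge].
Qed.

Lemma cell_core_compact p l : compact (cell_core p l).
Proof.
apply: bounded_closed_compact.
  have [K K0 NK] := norm_lower N.
  exists (K * rad + `|lat p|); split=> [|b bM y [yp _] /=]; first exact: num_real.
  rewrite ltW// (le_lt_trans _ bM)// -{1}(subrK (lat p) y).
  rewrite (le_trans (ler_normD _ _))// lerD2r (le_trans (NK _))//.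
  by rewrite ler_pM2l.
have -> : cell_core p l = [set y | N (y - lat p) <= rad] `&`
    \bigcap_(q in [set q | (rk (cls q) < rk (cls p))%N])
      [set y | rad + l.+1%:R^-1 <= N (y - lat q)].
  by apply/seteqP; split=> y [? h]; split=> // q; exact: h.
apply: closedI; first exact: closed_norm_le.
by apply: closed_bigI => q _; exact: closed_norm_ge.
Qed.

Lemma closed_sub_compact (E K : set 'rV[R]_n) : closed E -> compact K ->
  closed [set s | exists2 t, K t & E (s + t)].
Proof.
move=> cE cK; rewrite -openC openE => s /= sN.
rewrite /interior/=.
have : \forall s' \near s, K `<=` [set t | ~ E (s' + t)].
  apply: ((compact_near_coveringP K).1 cK _ (nbhs s)
    (fun s' t => ~ E (s' + t)) (nbhs_filter s)) => t Kt.
  have Est : ~ E (s + t) by move=> h; apply: sN; exists t.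
  have : open (~` E) by rewrite openC.
  rewrite openE => /(_ _ Est) /nbhs_normP[e /= e0 he].
  have e2 : 0 < e / 2 by rewrite divr_gt0.
  exists (ball t (e / 2), ball s (e / 2)); first by split; exact: nbhsx_ballx.
  move=> [t' s'] [/=]; rewrite -!ball_normE/= => tt' ss'; apply: he => /=.
  by rewrite opprD addrACA (le_lt_trans (ler_normD _ _))// (splitr e) ltrD.
by apply: filterS => s' h [t /h].
Qed.

(** The set in question is the Minkowski difference of the closed set [E] and the
    cell, which is a countable union of compact sets; hence it is a countable
    union of closed sets. *)
Lemma cell_hits_caratheodory s (E : set 'rV[R]_n) p : closed E ->
  (haus s).-caratheodory [set u | exists2 y, E y & cell p (y - u)].
Proof.
move=> cE.
have -> : [set u | exists2 y, E y & cell p (y - u)] =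
    \bigcup_l [set u | exists2 t, cell_core p l t & E (u + t)].
  apply/seteqP; split=> [u [y Ey]|u [l _ [t lt Eut]]].
    by rewrite cell_bigcup => -[l _ ly]; exists l => //; exists (y - u); rewrite ?subrKC.
  by exists (u + t) => //; rewrite addrC addKr cell_bigcup; exists l.
apply: caratheodory_countable_bigcup => l; apply: closed_haus_caratheodory.
by apply: closed_sub_compact => //; exact: cell_core_compact.
Qed.

End cells.

(** * Measures, events and partitions *)

Section measure_facts.
Context {R : realType}.

Lemma exists_normalized_restriction (T : pointedType)
    (mu : {outer_measure set T -> \bar R}) (D : set T) (c : R) :
    mu.-caratheodory D -> 0 < c -> mu D = c%:E ->
  exists P : probability (caratheodory_type mu) R,
    forall A, P A = (mu (A `&` D) * (c^-1)%:E)%E.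
Proof.
move=> mD c0 muD; pose U := caratheodory_type mu.
have mD' : measurable (D : set U) by [].
pose nu : {measure set U -> \bar R} :=
  mrestr (mu : {measure set U -> \bar R}) mD'.
exists (mnormalize nu (\d_(point : U) : probability U R)) => A.
have nuT : nu setT = c%:E by rewrite /nu/= /mrestr setTI.
exact: mnormalizeE A c0 nuT.
Qed.

Lemma sum_caratheodory_le (T : pointedType) (mu : {outer_measure set T -> \bar R})
    (I : finType) (F : I -> set T) (S : set T) :
    (forall i, mu.-caratheodory (F i)) -> trivIset setT F ->
    (forall i, F i `<=` S) ->
  (\sum_i mu (F i) <= mu S)%E.
Proof.
move=> mF tF FS; pose U := caratheodory_type mu.
pose G (j : 'I_#|I|) : set U := F (@enum_val I I j).
have mG j : measurable (G j) by exact: mF.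
have tG : trivIset setT G.
  by move=> j l _ _ jl; apply: enum_val_inj; exact: tF.
rewrite (reindex (@enum_val I I))/=; last exact: onW_bij (enum_val_bij I).
have mUG : measurable (\big[setU/set0]_(j < #|I|) G j).
  by apply: bigsetU_measurable => j _.
have /esym -> := measure_semi_additive_ord (mu : {measure set U -> \bar R}) mG tG mUG.
apply: le_outer_measure; elim/big_ind: _ => [//|A B AS BS|j _]; last exact: FS.
by rewrite subUset.
Qed.

Lemma measurable_sections d (T : measurableType d) (A : set (T * nat)) :
  (forall j, measurable [set s | A (s, j)]) -> measurable A.
Proof.
move=> mA; rewrite (_ : A = \bigcup_j ([set s | A (s, j)] `*` [set j])).
  by apply: bigcupT_measurable => j; exact: measurableX.
apply/seteqP; split=> [[s j] Asj|[s j] [l _ [/= Asl ->]]//].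
by exists j.
Qed.

(** Two points are separated when some cluster contains exactly one of them;
    this is an event because singletons are closed. *)
Lemma separation_measurable (M : metricType R) (P : random_partition M) (x y : M) :
  measurable [set w | @cluster_of R M P w x <> cluster_of w y].
Proof.
have mx (z : M) m : measurable [set w | @rp_set R M P m w z].
  rewrite (_ : [set w | _] = [set w | [set z] `&` @rp_set R M P m w !=set0]).
    by apply: rp_measurable; apply: accessible_closed_set1;
      apply: hausdorff_accessible; exact: metric_hausdorff.
  apply/seteqP; split=> w /=; first by move=> wz; exists z.
  by move=> [_ [-> ]].
have clE (w : rp_space P) (z : M) m :
    @rp_set R M P m w z -> cluster_of w z = @rp_set R M P m w.
  move=> wz; apply/seteqP; split=> u; last by move=> wu; exists m.
  move=> [l /= wlz wlu]; suff -> : m = l by [].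
  by apply: (@rp_disjoint R M P w) => //; exists z.
rewrite (_ : [set w | _] =
    \bigcup_m ([set w | @rp_set R M P m w x] `\` [set w | @rp_set R M P m w y])).
  by apply: bigcupT_measurable => m; exact: measurableD.
apply/seteqP; split=> w /=.
  move=> sep; have : (\bigcup_m @rp_set R M P m w) x by rewrite rp_cover.
  move=> [m _ wx]; exists m => //; split=> // wy; apply: sep.
  by rewrite (clE _ _ _ wx) (clE _ _ _ wy).
move=> [m _ [wx wy]] e; apply: wy; have : cluster_of w y y.
  have : (\bigcup_m @rp_set R M P m w) y by rewrite rp_cover.
  by move=> [l _ wy]; exists l.
by rewrite -e (clE _ _ _ wx).
Qed.

End measure_facts.

(** * Counting lattice points by volume *)

Section lattice_sums.
Context {R : realType} {n : nat} (I : finType) (cls : 'rV[int]_n -> I).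

Lemma cube1_lat (p : 'rV[int]_n) (x : 'rV[R]_n) :
  cube 1 0 (x - lat p) <-> cube 1 (lat p) x.
Proof.
by split=> h i; have := h i; rewrite !mxE add0r subr_ge0 ltrBlDl.
Qed.

Lemma mem_cube1_lat (x : 'rV[R]_n) : exists p, cube 1 (lat p) x.
Proof. by have [p] := lat_mem_cube x ltr01; rewrite scale1r => px; exists p. Qed.

Lemma cube1_lat_inj (x : 'rV[R]_n) p q :
  cube 1 (lat p) x -> cube 1 (lat q) x -> p = q.
Proof. by have := @lat_cube_inj R n 1 x p q ltr01; rewrite !scale1r. Qed.

Definition lattice_trace (S : set 'rV[R]_n) (i : I) : set 'rV[R]_n :=
  [set s | exists2 p, cls p = i & S (s + lat p)].

Variable S : set 'rV[R]_n.
Hypothesis mS : forall a, (haus n).-caratheodory [set s | S (s + a)].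

Lemma lattice_trace_caratheodory i : (haus n).-caratheodory (lattice_trace S i).
Proof.
rewrite (_ : lattice_trace S i = \bigcup_p
    (if cls p == i then [set s | S (s + lat p)] else set0)).
  apply: caratheodory_countable_bigcup => p; case: ifP => // _.
  exact: caratheodory_measurable_set0.
apply/seteqP; split=> [s [p pi Ssp]|s [p _]]; first by exists p => //; rewrite pi eqxx.
by case: eqP => // pi Ssp; exists p.
Qed.

(** The shifts in the unit cube that move the lattice point [p] into [S] form a
    translate of the part of [S] in the unit cube at [p], and these cubes tile the
    space.  Thus the measure of [S], in units of the measure of the cube, is the
    expected number of lattice points in [S]; an inequality results, as at most
    one point is counted in each class. *)
Lemma sum_haus_lattice_trace :
  (\sum_i haus n (lattice_trace S i `&` cube 1 0) <= haus n S)%E.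
Proof.
pose F i := \bigcup_p (if cls p == i then S `&` cube 1 (lat p) else set0).
have FP i u : F i u -> exists2 p, cls p = i & S u /\ cube 1 (lat p) u.
  by move=> [p _]; case: eqP => // pi [? ?]; exists p.
have mS0 : (haus n).-caratheodory S.
  have := mS 0; rewrite (_ : [set s | _] = S)//.
  by apply/seteqP; split=> s /=; rewrite addr0.
have mcell i p :
    (haus n).-caratheodory (if cls p == i then S `&` cube 1 (lat p) else set0).
  case: ifP => _; last exact: caratheodory_measurable_set0.
  by apply: caratheodory_measurable_setI => //; exact: cube_caratheodory.
apply: (@le_trans _ _ (\sum_i haus n (F i))%E); last first.
  apply: sum_caratheodory_le =>
    [i|i j _ _ [u [/FP[p pi [_ pu]] /FP[q qj [_ qu]]]]|i u /FP[p _ []]//].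
    exact: caratheodory_countable_bigcup.
  by rewrite -pi -qj (cube1_lat_inj pu qu).
apply: lee_sum => i _.
pose P p := [set s | [/\ cls p = i, S (s + lat p) & cube 1 0 s]].
have PE p : [set x | P p (x - lat p)] = if cls p == i then S `&` cube 1 (lat p) else set0.
  apply/seteqP; split=> x; rewrite /P /= subrK.
    by move=> [-> Sx /cube1_lat xp]; rewrite eqxx.
  by case: eqP => // -> [Sx /cube1_lat xp].
apply: (haus_pieces (P := P) (v := fun p => - lat p)).
- by move=> s [[p pi Ss] s0]; exists p.
- by move=> p; rewrite PE; exact: mcell.
- by move=> p q _ _ [x [[_ _ /cube1_lat xp] [_ _ /cube1_lat xq]]]; exact: cube1_lat_inj xp xq.
- move=> p x; rewrite -[P p _]/([set x | P p (x - lat p)] x) PE => h.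
  by exists p.
Qed.

End lattice_sums.

Section lattice_count.
Context {R : realType} {n : nat} (N : norm R n) (rad kappa V : R).
Context (I : finType) (cls : 'rV[int]_n -> I).
Hypothesis Nkappa : forall x, N x <= kappa * `|x|.
Hypothesis kappa0 : 0 < kappa.
Hypothesis cls_inj : forall p q,
  cls p = cls q -> N (lat p - lat q) <= 2 * rad + 2 -> p = q.
Hypothesis V_le : (V%:E <= haus n [set u | (N u <= rad - kappa)%R])%E.

Lemma near_lat (u : 'rV[R]_n) p : cube 1 (lat p) u -> N (u - lat p) <= kappa.
Proof.
move=> pu; apply: le_trans (Nkappa _) _; rewrite ger_pMr//.
apply: (@cube_dist _ _ 1 (lat p)) => // i.
by rewrite lexx/= ltrDl.
Qed.

(** The unit cubes at the lattice points of a ball cover the ball of radius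
    smaller by [kappa], and distinct lattice points of the ball have distinct
    classes. *)
Lemma count_lattice_classes (y : 'rV[R]_n) (W : {set I}) :
    (forall p, N (y - lat p) <= rad -> cls p \in W) ->
  V <= #|W|%:R * hconst n.
Proof.
move=> yW; rewrite -lee_fin; apply: le_trans V_le _.
have /choice[p pP] (i : I) : exists p : 'rV[int]_n, forall q,
    cls q = i -> N (y - lat q) <= rad -> q = p.
  have [[p [pi yp]]|none] := pselect (exists p, cls p = i /\ N (y - lat p) <= rad).
    exists p => q qi yq; apply: cls_inj; first by rewrite qi.
    by rewrite (le_trans (dist_centers yq yp))//; lra.
  by exists 0 => q qi yq; case: none; exists q.
pose F i : set 'rV[R]_n := if i \in W then cube 1 (lat (p i)) else set0.
rewrite -(haus_translate n y).
apply: (@le_trans _ _ (haus n (\bigcup_i F i))).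
  apply: le_outer_measure => _ [u ur <-]; have [q qu] := mem_cube1_lat (u + y).
  have yq : N (y - lat q) <= rad.
    have -> : y - lat q = (u + y - lat q) - u by rewrite addrAC [u + y]addrC addrK.
    rewrite (le_trans (norm_triangle _ _ _))// normN.
    by have := near_lat qu; move: ur => /=; lra.
  exists (cls q) => //; rewrite /F yW// -(pP _ _ erefl yq)//.
apply: le_trans (haus_finite_subadditive _ _) _.
apply: (@le_trans _ _ (\sum_i (if i \in W then hconst n else 0)%:E)%E).
  apply: lee_sum => i _; rewrite /F; case: ifP => _; last by rewrite outer_measure0.
  by rewrite haus_cube// expr1n mul1r.
by rewrite sumEFin -big_mkcond sumr_const mulr_natl.
Qed.

End lattice_count.

(** * The random partition *)

(** Tonelli's theorem, for an event with uniformly small sections over [A]. *)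
Lemma product_probability_le d1 d2 (T1 : measurableType d1) (T2 : measurableType d2)
    {R : realType} (P : probability T1 R) (Q : probability T2 R)
    (G : set (T1 * T2)) (A : set T1) (c : R) : 0 <= c ->
    measurable G -> measurable A -> (forall s t, G (s, t) -> A s) ->
    (forall s, A s -> (Q [set t | G (s, t)] <= c%:E)%E) ->
  ((P \x Q) G <= c%:E * P A)%E.
Proof.
move=> c0 mG mA GA Qc; have mf : measurable_fun [set: T1] (EFin \o (\1_A : T1 -> R)).
  by apply/measurable_EFinP; exact: measurable_indic.
have f0 s : [set: T1] s -> (0 <= (EFin \o (\1_A : T1 -> R)) s)%E by rewrite lee_fin.
rewrite -[X in P X]setIT -(integral_indic P measurableT mA).
have <- := ge0_integralZl P measurableT mf f0 (_ : (0 <= c%:E)%E); last first.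
  by rewrite lee_fin.
apply: ge0_le_integral => //.
- exact: (measurable_fun_xsection Q mG).
- exact: measurable_funeM.
move=> s _ /=; rewrite xsectionE; have [As|As] := pselect (A s).
  by rewrite indicE mem_set// mule1 Qc.
rewrite (_ : _ @^-1` _ = set0) ?measure0 ?mule_ge0 ?lee_fin//.
by apply/seteqP; split=> // t /GA.
Qed.

Lemma measure_finite_subadditive d (T : measurableType d) {R : realType}
    (mu : {measure set T -> \bar R}) (I : finType) (F : I -> set T) (A : set T) :
    (forall i, measurable (F i)) -> measurable A -> A `<=` \bigcup_i F i ->
  (mu A <= \sum_i mu (F i))%E.
Proof.
move=> mF mA AF; rewrite fsbig_seq ?index_enum_uniq//.
have -> : [set` index_enum I] = [set: I].
  by apply/seteqP; split=> // i _; rewrite /= mem_index_enum.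
by apply: content_sub_fsum => //; exact: finite_finset.
Qed.

Section lattice_partition.
Context {R : realType} {n : nat} (X N : norm R n) (C : set 'rV[R]_n).
Context (I : finType) (cls : 'rV[int]_n -> I) (rk : nat -> I -> nat).
Context (rho rad kappa : R).
Context (P : probability (caratheodory_type (@haus R n n)) R) (Q : probability nat R).
Hypothesis closedC : closed C.
Hypothesis rho0 : 0 < rho.
Hypothesis kappa0 : 0 < kappa.
Hypothesis kappa_rad : kappa <= rad.
Hypothesis Nkappa : forall x, N x <= kappa * `|x|.
Hypothesis cls_inj : forall p q,
  cls p = cls q -> N (lat p - lat q) <= 2 * rad + 2 -> p = q.
Hypothesis rk_inj : forall j, injective (rk j).

Let M := metric_subspace (C : set (normed_space X)).
Let Omega := (caratheodory_type (@haus R n n) * nat)%type.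
(* Instead of refining the lattice, [C] is dilated by [rho]. *)
Let pos (x : M) : 'rV[R]_n := rho *: (set_val x : 'rV[R]_n).

Lemma closed_pos_image (E : set M) : closed E -> closed (pos @` E).
Proof.
move=> cE; have [K K0 XK] := norm_upper X.
have -> : pos @` E = ( *:%R rho^-1) @^-1` [set c | exists2 x, E x & set_val x = c].
  apply/seteqP; split=> [_ [x Ex <-]|c [x Ex xc]].
    by exists x => //=; rewrite scalerA mulVf ?gt_eqF// scale1r.
  by exists x => //; rewrite /pos xc scalerA mulfV ?gt_eqF// scale1r.
apply: closed_comp => [x _|].
  apply: (@lipschitz_continuous _ _ _ _ rho^-1) => [|u w]; first by rewrite invr_gt0.
  by rewrite -scalerBr normrZ gtr0_norm// invr_gt0.
rewrite -openC openE => c cN; have [Cc|Cc] := pselect (C c); last first.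
  have : open (~` C) by rewrite openC.
  rewrite openE => /(_ _ Cc); apply: filterS => c' Cc' [x _ xc]; apply: Cc'.
  by rewrite -xc; exact: set_valP.
pose x0 : M := exist _ c (mem_set Cc).
have Ex0 : ~ E x0 by move=> Ex0; apply: cN; exists x0.
have : open (~` E) by rewrite openC.
rewrite openE => /(_ _ Ex0); rewrite /interior/= -nbhs_ballE => -[e /= e0 he].
have := nbhsx_ballx c _ (divr_gt0 e0 K0); apply: filterS => c'.
rewrite -ball_normE/= => cc' [x Ex xc]; apply: (he x) => //.
rewrite ballEmdist/=; change (X (c - set_val x) < e); rewrite xc.
by rewrite (le_lt_trans (XK _))// mulrC -ltr_pdivlMr.
Qed.

(** The first component of [w] is the shift of the lattice, the second one the
    index of the order.  Numbers that encode no lattice point give empty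
    clusters. *)
Definition lattice_cluster (m : nat) (w : Omega) : set M :=
  [set x | exists2 p, pickle_inv m = Some p &
    cell N rad cls (rk w.2) p (pos x - w.1)].

Lemma lattice_cluster_cover w : \bigcup_m lattice_cluster m w = setT.
Proof.
apply/seteqP; split=> // x _.
have [p px] := mem_cube1_lat (pos x - w.1).
have [q qx] : exists q, cell N rad cls (rk w.2) q (pos x - w.1).
  by apply: cell_cover; exists p; apply: le_trans kappa_rad; exact: near_lat px.
by exists (pickle q) => //; exists q => //; rewrite pickleK_inv.
Qed.

Lemma lattice_cluster_trivIset w : trivIset setT (fun m => lattice_cluster m w).
Proof.
move=> m l _ _ [x [[p mp px] [q lq qx]]].
have rad0 : 0 < rad by exact: lt_le_trans kappa_rad.
have pq : p = q by apply: cell_inj px qx.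
have := @pickle_invK 'rV[int]_n m; have := @pickle_invK 'rV[int]_n l.
by rewrite mp lq/= pq => <- <-.
Qed.

Lemma lattice_cluster_measurable m (E : set M) : closed E ->
  measurable [set w : Omega | E `&` lattice_cluster m w !=set0].
Proof.
move=> cE; apply: measurable_sections => j.
case mp : (pickle_inv m) => [p|]; last first.
  rewrite (_ : [set s | _] = set0)//; apply/seteqP; split=> // s [x [_ [p]]].
  by rewrite mp.
rewrite (_ : [set s | _] =
    [set u | exists2 y, (pos @` E) y & cell N rad cls (rk j) p (y - u)]).
  exact: cell_hits_caratheodory (closed_pos_image cE).
apply/seteqP; split=> s.
  move=> [x [Ex [q]]]; rewrite mp => -[<-] px.
  by exists (pos x) => //; exists x.
by move=> [_ [x Ex <-] px]; exists x; split=> //; exists p.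
Qed.

Definition lattice_partition : random_partition M :=
  @RandomPartition R M _ Omega (P \x Q)%E lattice_cluster lattice_cluster_cover
    lattice_cluster_trivIset lattice_cluster_measurable.

Lemma lattice_partition_bounded (alpha Delta : R) : 0 <= Delta ->
    (forall x y, C x -> C y -> X (x - y) <= alpha * N (x - y)) ->
    0 <= alpha -> alpha * (2 * rad) <= rho * Delta ->
  bounded_partition Delta lattice_partition.
Proof.
move=> Delta0 XN alpha0 ad w m; apply/diam_leP => // x y [p mp px] [q].
rewrite mp => -[<-] py; change (X (set_val x - set_val y) <= Delta).
apply: le_trans (XN _ _ (set_valP x) (set_valP y)) _.
rewrite -(ler_pM2l rho0); apply: le_trans ad.
rewrite mulrCA ler_wpM2l//.
have := cell_diam px py; rewrite opprB addrA subrK /pos -scalerBr.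
by rewrite norm_homogeneous gtr0_norm.
Qed.

Section separation.
Variables (V : R) (a b : 'rV[R]_n).
Hypothesis V0 : 0 < V.
Hypothesis V_le : (V%:E <= haus n [set u | (N u <= rad - kappa)%R])%E.
Hypothesis PE : forall A, P A = (haus n (A `&` cube 1 0) * ((hconst n)^-1)%:E)%E.
Hypothesis QE : forall (W : {set I}) i, i \in W ->
  (Q [set j | forall w, w \in W -> (rk j i <= rk j w)%N] <= (#|W|%:R^-1)%:E)%E.

Let Ka := [set u | N (u - a) <= rad].
Let Kb := [set u | N (u - b) <= rad].
Let SD := (Ka `\` Kb) `|` (Kb `\` Ka).

(* The classes of the lattice points in [Ka] or [Kb] are those of the balls that
   contain [a] or [b]; here [i] is the first of them, and some ball of class [i]
   contains only one of the two points. *)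
Let first_separates i : set Omega := [set w | lattice_trace cls SD i w.1 /\
  forall i', lattice_trace cls (Ka `|` Kb) i' w.1 -> (rk w.2 i <= rk w.2 i')%N].

Let mK (c d : 'rV[R]_n) : (haus n).-caratheodory [set s | N (s + d - c) <= rad].
Proof.
apply: closed_haus_caratheodory.
by apply: (@closed_translate _ _ [set s | N (s - c) <= rad] d); exact: closed_norm_le.
Qed.

Let mSD d : (haus n).-caratheodory [set s | SD (s + d)].
Proof.
by apply: caratheodory_measurable_setU; apply: caratheodory_measurable_setD; exact: mK.
Qed.

Let mKU d : (haus n).-caratheodory [set s | (Ka `|` Kb) (s + d)].
Proof. by apply: caratheodory_measurable_setU; exact: mK. Qed.

Let first_separates_measurable i : measurable (first_separates i).
Proof.
apply: measurable_sections => j.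
rewrite (_ : [set s | _] = lattice_trace cls SD i `&`
    \bigcap_i' (if (rk j i <= rk j i')%N then setT
                else ~` lattice_trace cls (Ka `|` Kb) i')).
  apply: caratheodory_measurable_setI; first exact: lattice_trace_caratheodory.
  apply: caratheodory_countable_bigcap => i'; case: ifP => _.
    rewrite -setC0; apply: caratheodory_measurable_setC.
    exact: caratheodory_measurable_set0.
  by apply: caratheodory_measurable_setC; exact: lattice_trace_caratheodory.
apply/seteqP; split=> s [sD h]; split=> // i'.
  by move=> _; case: ifPn => // + /h; move=> /negP.
by move=> si'; have := h i' Logic.I; case: ifP.
Qed.

Let first_separates_le i : ((P \x Q)%E (first_separates i) <=
  (hconst n / V)%:E * P (lattice_trace cls SD i))%E.
Proof.
apply: product_probability_le.
- by rewrite divr_ge0// ltW// hconst_gt0.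
- exact: first_separates_measurable.
- exact: lattice_trace_caratheodory.
- by move=> s j [].
move=> s sD.
pose W : {set I} := [set i' | `[< lattice_trace cls (Ka `|` Kb) i' s >]]%SET.
have WP i' : i' \in W <-> lattice_trace cls (Ka `|` Kb) i' s.
  by rewrite inE; split=> [/asboolP|?]; [|apply/asboolP].
have iW : i \in W.
  apply/WP; have [p pi SDp] := sD; exists p => //.
  by case: SDp => [[? _]|[? _]]; [left|right].
have VW : V <= #|W|%:R * hconst n.
  apply: (@count_lattice_classes _ _ N rad kappa _ _ cls Nkappa kappa0 cls_inj
    V_le (a - s)) => p ap.
  apply/WP; exists p => //; left; rewrite /Ka/=.
  by rewrite norm_distC opprD addrA.
have W0 : 0 < #|W|%:R :> R.
  by rewrite ltr0n; apply/card_gt0P; exists i.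
apply: (@le_trans _ _ (#|W|%:R^-1)%:E).
  apply: le_trans (QE iW); apply: le_measure; rewrite ?inE//.
  by move=> j [_ h] i' /WP; exact: h.
by rewrite lee_fin ler_pdivlMr// mulrC ler_pdivrMr// mulrC.
Qed.

(** Take the first center [p] whose ball contains [a] or [b].  If that ball contains
    both, then both points are in the cell of [p].  Otherwise the class of [p]
    realizes one of the events [first_separates]. *)
Lemma lattice_partition_separation (x y : M) : pos x = a -> pos y = b ->
  (rp_prob lattice_partition
     [set w | @cluster_of _ _ lattice_partition w x <> cluster_of w y] <=
   (V^-1)%:E * haus n SD)%E.
Proof.
move=> xa yb; have msep := @separation_measurable R M lattice_partition x y.
have sub : [set w | @cluster_of _ _ lattice_partition w x <> cluster_of w y] `<=`
    \bigcup_i first_separates i.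
  move=> [s j] /= sep.
  have exU : exists p, (Ka `|` Kb) (s + lat p).
    have [p pa] := mem_cube1_lat (a - s); exists p; left; rewrite /Ka/=.
    rewrite norm_distC opprD addrA; apply: le_trans kappa_rad; exact: near_lat pa.
  have [p Up pmin] := exists_first cls (rk j) exU.
  have pmin' i' : lattice_trace cls (Ka `|` Kb) i' s -> (rk j (cls p) <= rk j i')%N.
    by move=> [q <- /pmin].
  exists (cls p) => //; split=> //=; exists p => //.
  apply: contrapT => pSD; apply: sep.
  have [pa pb] : Ka (s + lat p) /\ Kb (s + lat p).
    have [pa|pa] := pselect (Ka (s + lat p));
      have [pb|pb] := pselect (Kb (s + lat p)) => //.
    - by exfalso; apply: pSD; left.
    - by exfalso; apply: pSD; right.
    - by case: Up.
  have ball_cell (z : M) c : pos z = c -> N (s + lat p - c) <= rad ->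
      (forall q, N (s + lat q - c) <= rad -> (Ka `|` Kb) (s + lat q)) ->
      lattice_cluster (pickle p) (s, j) z.
    move=> zc pc cU; exists p; first by rewrite pickleK_inv.
    rewrite /= zc; split=> [|q qp].
      by rewrite norm_distC opprB addrA [lat p + s]addrC.
    rewrite ltNge; apply/negP => qc; have : (Ka `|` Kb) (s + lat q).
      by apply: cU; rewrite norm_distC opprD addrA.
    by move=> /pmin; rewrite leqNgt qp.
  have xp := ball_cell x a xa pa (fun q h => or_introl h).
  have yp := ball_cell y b yb pb (fun q h => or_intror h).
  have clE (z : M) : lattice_cluster (pickle p) (s, j) z ->
      @cluster_of _ _ lattice_partition (s, j) z = lattice_cluster (pickle p) (s, j).
    move=> zp; apply/seteqP; split=> u; last by move=> up; exists (pickle p).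
    move=> [l /= zl ul]; suff -> : pickle p = l by [].
    by apply: (lattice_cluster_trivIset (w := (s, j))) => //; exists z.
  by rewrite (clE _ xp) (clE _ yp).
apply: (@le_trans _ _ (\sum_i (P \x Q) (first_separates i))%E).
  by apply: measure_finite_subadditive => // i; exact: first_separates_measurable.
apply: (@le_trans _ _
    (\sum_i (V^-1)%:E * haus n (lattice_trace cls SD i `&` cube 1 0))%E).
  apply: lee_sum => i _; apply: le_trans (first_separates_le i) _.
  rewrite PE muleCA -EFinM (_ : hconst n / V / hconst n = V^-1) 1?muleC//.
  by rewrite mulrAC divff ?mul1r// gt_eqF// hconst_gt0.
rewrite -ge0_sume_distrr; last by move=> i _; exact: outer_measure_ge0.
rewrite lee_pmul2l ?lte_fin ?invr_gt0//.
exact: sum_haus_lattice_trace.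
Qed.

End separation.

End lattice_partition.

(** * Volumes of balls *)

Section norm_balls.
Context {R : realType} {n : nat} (N : norm R n).

Lemma norm_ball_scale (r : R) : 0 < r ->
  [set u | N u <= r] = *:%R r @` unit_ball N.
Proof.
move=> r0; apply/seteqP; split=> [u ur|_ [u u1 <-]]; last first.
  by rewrite /= norm_homogeneous gtr0_norm// ger_pMr.
exists (r^-1 *: u); last by rewrite scalerA mulfV ?scale1r// gt_eqF.
by rewrite /unit_ball/= norm_homogeneous gtr0_norm ?invr_gt0// ler_pdivrMl// mulr1.
Qed.

Lemma haus_unit_ball_gt0 : (0 < haus n (unit_ball N))%E.
Proof.
have [K K0 NK] := norm_upper N; have K1 : 0 < K^-1 by rewrite invr_gt0.
apply: (@lt_le_trans _ _ (haus n (cube K^-1 (0 : 'rV[R]_n)))).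
  by rewrite haus_cube// lte_fin mulr_gt0 ?exprn_gt0 ?hconst_gt0.
apply: le_outer_measure => x xK; rewrite /unit_ball/=.
apply: le_trans (NK _) _; rewrite -ler_pdivlMl// mulr1 -[x]subr0.
by apply: cube_dist xK _; [exact: ltW|move=> i; rewrite lexx/= ltrDl].
Qed.

Lemma haus_unit_ball_fin : (haus n (unit_ball N) < +oo)%E.
Proof.
have [K K0 NK] := norm_lower N; have K3 : 0 < 3 * K by rewrite mulr_gt0.
apply: (@le_lt_trans _ _ (haus n (cube (3 * K) (const_mx (- K) : 'rV[R]_n)))); last first.
  by rewrite haus_cube// ltry.
apply: le_outer_measure => x x1 i; rewrite mxE.
have : `|x 0 i| <= K.
  apply: le_trans (entry_le_mx_norm _ i) _; apply: le_trans (NK _) _.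
  by rewrite ger_pMr.
by rewrite ler_norml => /andP[? ?]; lra.
Qed.

Lemma norm_ball_closed (r : R) : closed [set u | N u <= r].
Proof.
by have := closed_norm_le (N := N) (a := 0) (r := r); under eq_set do rewrite subr0.
Qed.

Lemma norm_ball_segment_closed (r : R) : segment_closed [set u | N u <= r].
Proof.
move=> x y l xr yr /andP[l0 l1]; rewrite /= (le_trans (norm_triangle _ _ _))//.
rewrite !norm_homogeneous !ger0_norm ?subr_ge0//.
rewrite -[leRHS](subrKC (l * r)) -{2}[r]mul1r -mulrBl.
by rewrite lerD// ler_wpM2l// subr_ge0.
Qed.

Lemma proj_orthZl (c : R) (z x : 'rV[R]_n) : c != 0 ->
  proj_orth (c *: z) x = proj_orth z x.
Proof.
move=> c0; rewrite /proj_orth; have [->|z0] := eqVneq z 0; first by rewrite !scaler0.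
rewrite dotZl !dotZr scalerA; congr (_ - _ *: _); field.
by rewrite dot_eq0 z0 c0.
Qed.

Lemma proj_orthZr (c : R) (z x : 'rV[R]_n) :
  proj_orth z (c *: x) = c *: proj_orth z x.
Proof. by rewrite /proj_orth dotZl scalerBr scalerA mulrA. Qed.

End norm_balls.

Section ball_shift.
Context {R : realType} {k : nat} (N : norm R k.+1).

Lemma haus_ball_shift (rad : R) (z : 'rV[R]_k.+1) : z != 0 -> 0 < rad ->
  (haus k.+1 [set u | (N u <= rad)%R /\ ~ (N (u - z) <= rad)%R] <=
   (l2norm z * hconst k.+1 / hconst k * rad ^+ k)%:E *
     haus k (proj_orth z @` unit_ball N))%E.
Proof.
move=> z0 rad0; have [A A0 NA] := norm_upper N.
have [B B0 hB] := norm_lower (@l2norm R k.+1).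
have AB0 : 0 < rad / (A * B) by rewrite divr_gt0 ?mulr_gt0.
apply: (@le_trans _ _ ((l2norm z * hconst k.+1 / hconst k)%:E *
    haus k (proj_orth z @` [set u | (N u <= rad)%R]))%E).
  apply: (haus_shift_le z0 AB0).
  - exact: norm_ball_closed.
  - exact: norm_ball_segment_closed.
  move=> x; rewrite ler_pdivlMr ?mulr_gt0// => xr; apply: le_trans (NA _) _.
  apply: le_trans xr; rewrite mulrCA ler_pM2l// mulrC; exact: hB.
have -> : proj_orth z @` [set u | (N u <= rad)%R] =
    *:%R rad @` (proj_orth z @` unit_ball N).
  rewrite norm_ball_scale//; apply/seteqP; split=> _ [_ [x x1 <-] <-].
    by exists (proj_orth z x); [exists x|rewrite proj_orthZr].
  by exists (rad *: x); [exists x|rewrite proj_orthZr].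
by rewrite haus_scale// muleA -EFinM.
Qed.

End ball_shift.

Section volume_ratio.
Context {R : realType} {k : nat} (Y : norm R k.+1).

Lemma volE n s (A : set 'rV[R]_n) :
  vol s A = (haus s A * ((hconst s)^-1)%:E)%E.
Proof.
rewrite /vol -[X in (X / _)%E]/(haus s A) -[X in (_ / X)%E]/(haus s (unit_cube (n := s))).
by rewrite hconstE inver gt_eqF ?hconst_gt0.
Qed.

Let h : R := fine (haus k.+1 (unit_ball Y)).

Lemma haus_unit_ballE : haus k.+1 (unit_ball Y) = h%:E.
Proof.
by rewrite /h fineK// ge0_fin_numE ?haus_unit_ball_fin// ltW// haus_unit_ball_gt0.
Qed.

Let h0 : 0 < h. Proof. by rewrite -lte_fin -haus_unit_ballE haus_unit_ball_gt0. Qed.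

(** The form in which the bound [beta] on ratios of normalized volumes enters:
    solved for the Hausdorff measure of the projection. *)
Lemma volume_ratio_le (A : set 'rV[R]_k.+1) (c beta : R) : 0 < c ->
  (vol k A / vol k.+1 (unit_ball Y) * c%:E <= beta%:E)%E ->
  (haus k A <= (beta * h * hconst k / (hconst k.+1 * c))%:E)%E.
Proof.
move=> c0; rewrite !volE haus_unit_ballE -EFinM inver gt_eqF ?divr_gt0 ?hconst_gt0//.
rewrite -!muleA -!EFinM -lee_pdivlMr ?mulr_gt0 ?invr_gt0 ?divr_gt0 ?hconst_gt0//.
move=> /le_trans; apply.
rewrite -EFinM lee_fin le_eqVlt; apply/orP; left; apply/eqP; field.
by rewrite !gt_eqF ?hconst_gt0.
Qed.

End volume_ratio.

(** * Bounding the separation modulus *)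

Section separating_partitions.
Context {R : realType} {k : nat} (X Y : norm R k.+1) (C : set 'rV[R]_k.+1).
Context (alpha beta : R).
Hypothesis closedC : closed C.
Hypothesis alpha0 : 0 < alpha.
Hypothesis beta0 : 0 <= beta.
Hypothesis XY : forall x y, C x -> C y -> X (x - y) <= alpha * Y (x - y).
Hypothesis vol_beta : forall x y, C x -> C y -> x <> y ->
  (vol k (proj_orth (x - y)%R @` unit_ball Y) / vol k.+1 (unit_ball Y) *
   (l2norm (x - y)%R / X (x - y)%R)%:E <= beta%:E)%E.

Let h : R := fine (haus k.+1 (unit_ball Y)).

Let ball_shift_le (rho rad : R) (x y : 'rV[R]_k.+1) : 0 < rho -> 0 < rad ->
    C x -> C y -> x <> y ->
  (haus k.+1 [set u | (Y (u - rho *: x) <= rad)%R /\ ~ (Y (u - rho *: y) <= rad)%R] <=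
   (rho * rad ^+ k * beta * h * X (x - y))%:E)%E.
Proof.
move=> rho0 rad0 Cx Cy xy.
have z0 : y - x != 0 by apply/eqP => /eqP; rewrite subr_eq0 => /eqP yx; apply: xy.
pose z := rho *: (y - x); have z'0 : z != 0 by rewrite scaler_eq0 (gt_eqF rho0).
have -> : [set u | (Y (u - rho *: x) <= rad)%R /\ ~ (Y (u - rho *: y) <= rad)%R] =
    (fun u => u + rho *: x) @` [set u | Y u <= rad /\ ~ Y (u - z) <= rad].
  have zE u : u - rho *: x - z = u - rho *: y.
    by rewrite /z scalerBr opprB addrA subrK.
  apply/seteqP; split=> [u [ux uy]|_ [u [u0 uz] <-]].
    by exists (u - rho *: x); rewrite ?subrK//=; split=> //; rewrite zE.
  by rewrite /= -zE addrK.
rewrite haus_translate; apply: le_trans (haus_ball_shift Y z'0 rad0) _.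
have -> : proj_orth z @` unit_ball Y = proj_orth (y - x) @` unit_ball Y.
  by apply: eq_imagel => u _; rewrite proj_orthZl// gt_eqF.
have Xz : 0 < X (y - x) by rewrite norm_gt0.
have lz : 0 < l2norm (y - x) by rewrite norm_gt0.
have lX : 0 < l2norm (y - x) / X (y - x) by rewrite divr_gt0.
have := @volume_ratio_le R k Y _ _ beta lX (vol_beta Cy Cx (fun e => xy (esym e))).
rewrite -/h => hz.
apply: le_trans (lee_wpmul2l _ hz) _.
  by rewrite lee_fin ?mulr_ge0 ?invr_ge0 ?exprn_ge0 ?norm_ge0// ltW// hconst_gt0.
rewrite -EFinM lee_fin norm_homogeneous gtr0_norm// (norm_distC X).
rewrite le_eqVlt; apply/orP; left; apply/eqP; field.
by rewrite (norm_distC X x) !gt_eqF ?hconst_gt0.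
Qed.

(** Any [sigma] beyond [4 alpha beta] leaves room for the loss due to the mesh of the
    lattice. *)
Lemma exists_separating_partition (sigma Delta : R) :
    4 * alpha * beta < sigma -> 0 < Delta ->
  exists P : random_partition (metric_subspace (C : set (normed_space X))),
    bounded_partition Delta P /\ separating sigma Delta P.
Proof.
move=> s_gt Delta0; pose ab := 4 * alpha * beta.
have ab0 : 0 <= ab by rewrite !mulr_ge0// ltW.
have ab1 : 0 < ab + 1 by rewrite ltr_wpDl.
have h0 : 0 < h by rewrite -lte_fin -haus_unit_ballE haus_unit_ball_gt0.
have [kappa kappa0 Ykappa] := norm_upper Y.
have d0 : 0 < (sigma - ab) / (ab + 1) by rewrite divr_gt0// subr_gt0.
have [r r1 rk1] := @exists_exprn_close R k.+1 1 _ ler01 d0.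
have r10 : 0 < r - 1 by rewrite subr_gt0.
have r0 : 0 < r by exact: lt_trans r1.
have abr : ab * r ^+ k.+1 <= sigma.
  apply: le_trans (ler_wpM2l ab0 rk1) _; rewrite expr1n mulrDr mulr1.
  rewrite -lerBrDl mulrCA ger_pMr ?subr_gt0// ler_pdivrMr// mul1r lerDl ler01//.
(* [rad] solves [rad / (rad - kappa) = r]; this ratio will enter to the power
   [k.+1], which [sigma] can afford. *)
pose rad := kappa * r / (r - 1).
have radE : rad - kappa = kappa / (r - 1) by rewrite /rad; field; rewrite gt_eqF.
have radk0 : 0 < rad - kappa by rewrite radE divr_gt0.
have rad0 : 0 < rad by rewrite divr_gt0 ?mulr_gt0.
(* The dilation that makes [rad] correspond to the radius
   [Delta / (2 * alpha)]. *)
pose rho := 2 * alpha * rad / Delta.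
have rho0 : 0 < rho by apply: divr_gt0 => //; apply: mulr_gt0 => //; exact: mulr_gt0.
have [I [cls cls_inj]] := exists_lattice_classes Y (2 * rad + 2).
have [Q [rk [rk_inj QE]]] := @exists_random_order R I.
have c0 := @hconst_gt0 R k.+1.
have cubeE1 : haus k.+1 (cube 1 (0 : 'rV[R]_k.+1)) = (hconst k.+1)%:E.
  by rewrite haus_cube// expr1n mul1r.
have [P PE] := exists_normalized_restriction
  (cube_caratheodory k.+1 1 (0 : 'rV[R]_k.+1)) c0 cubeE1.
have kr : kappa <= rad by rewrite -subr_ge0 ltW.
exists (lattice_partition X P Q closedC rho0 kappa0 kr Ykappa cls_inj rk_inj).
split.
  apply: (lattice_partition_bounded (alpha := alpha)).
  - exact: ltW.
  - exact: XY.
  - exact: ltW.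
  - by rewrite /rho divfK ?gt_eqF// mulrCA mulrA.
move=> x y; have [->|xy] := eqVneq x y.
  rewrite (_ : [set w | _] = set0) ?measure0; last by apply/seteqP; split=> w /=.
  by rewrite mdistxx mulr0.
have V0 : 0 < (rad - kappa) ^+ k.+1 * h by rewrite mulr_gt0 ?exprn_gt0.
have V_le : (((rad - kappa) ^+ k.+1 * h)%:E <=
    haus k.+1 [set u | (Y u <= rad - kappa)%R])%E.
  by rewrite norm_ball_scale// haus_scale// haus_unit_ballE -/h -EFinM.
apply: le_trans (lattice_partition_separation closedC rho0 kappa0 kr Ykappa cls_inj
  rk_inj V0 V_le PE QE erefl erefl) _.
have Cx : C (set_val x) by exact: set_valP.
have Cy : C (set_val y) by exact: set_valP.
have xy' : (set_val x : 'rV[R]_k.+1) <> set_val y.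
  by move=> e; move/eqP: xy; apply; exact: val_inj.
apply: (@le_trans _ _ (((rad - kappa) ^+ k.+1 * h)^-1%:E *
  (2 * (rho * rad ^+ k * beta * h * X (set_val x - set_val y)))%:E)%E).
  apply: lee_wpmul2l; first by rewrite lee_fin invr_ge0 ltW.
  apply: le_trans (outer_measureU2 _ _ _) _.
  rewrite mulrDl mul1r EFinD leeD//; first exact: ball_shift_le.
  by rewrite (norm_distC X); apply: ball_shift_le => // e; apply: xy'.
rewrite -EFinM lee_fin -[mdist x y]/(X (set_val x - set_val y)).
set t := X _; have t0 : 0 <= t by exact: norm_ge0.
pose u := rad - kappa; rewrite -/u; have radM : rad = r * u by rewrite /u radE /rad; ring.
have -> : (u ^+ k.+1 * h)^-1 * (2 * (rho * rad ^+ k * beta * h * t)) =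
    ab * r ^+ k.+1 / Delta * t.
  rewrite /ab /rho radM exprMn !exprS; field.
  by rewrite !gt_eqF ?exprn_gt0.
by rewrite ler_wpM2r// ler_wpM2r// invr_ge0 ltW.
Qed.

End separating_partitions.

Lemma norm_equivalence (R : realType) (n : nat) (X Y : norm R n) :
  exists2 K, 0 < K & forall x, X x <= K * Y x.
Proof.
have [A A0 XA] := norm_upper X; have [B B0 YB] := norm_lower Y.
exists (A * B); first exact: mulr_gt0.
by move=> x; rewrite -mulrA (le_trans (XA x))// ler_pM2l.
Qed.

Lemma vol_ge0 (R : realType) (n s : nat) (A : set 'rV[R]_n) : (0 <= vol s A)%E.
Proof.
by rewrite volE mule_ge0 ?outer_measure_ge0// lee_fin invr_ge0 ltW// hconst_gt0.
Qed.

Theorem theorem76 (R : realType) (n : nat) (X Y : norm R n)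
    (C : set 'rV[R]_n) (closedC : closed C)
    (C2 : exists x y, [/\ C x, C y & x <> y]) :
  (SEP (metric_subspace (C : set (normed_space X))) <=
   4%:E *
   ereal_sup [set (X (p.1 - p.2)%R / Y (p.1 - p.2)%R)%:E | p in distinct_pairs C] *
   ereal_sup [set vol n.-1 (proj_orth (p.1 - p.2)%R @` unit_ball Y) /
                  vol n (unit_ball Y) *
                  (l2norm (p.1 - p.2)%R / X (p.1 - p.2)%R)%:E
             | p in distinct_pairs C])%E.
Proof.
have [x0 [y0 [Cx0 Cy0 xy0]]] := C2.
case: n => [|k] in X Y C closedC C2 x0 y0 Cx0 Cy0 xy0 *.
  by exfalso; apply: xy0; apply/rowP => -[].
set alpha := (X in (_ <= _ * X * _)%E); set beta := (X in (_ <= _ * X)%E).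
have sub_gt0 (N : norm R k.+1) x y : x <> y -> 0 < N (x - y).
  by move=> xy; rewrite norm_gt0// subr_eq0; apply/eqP.
have alpha_ub x y : C x -> C y -> x <> y -> ((X (x - y) / Y (x - y))%:E <= alpha)%E.
  by move=> *; apply: ereal_sup_ubound; exists (x, y).
have beta_ub x y : C x -> C y -> x <> y ->
    (vol k (proj_orth (x - y)%R @` unit_ball Y) / vol k.+1 (unit_ball Y) *
     (l2norm (x - y)%R / X (x - y)%R)%:E <= beta)%E.
  by move=> *; apply: ereal_sup_ubound; exists (x, y).
have [a a0 alphaE] : exists2 a, 0 < a & alpha = a%:E.
  have [K K0 XK] := norm_equivalence X Y.
  have alpha_gt0 : (0 < alpha)%E.
    apply: lt_le_trans (alpha_ub _ _ Cx0 Cy0 xy0).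
    by rewrite lte_fin divr_gt0 ?sub_gt0.
  have alphaK : (alpha <= K%:E)%E.
    apply: ge_ereal_sup => _ [[x y] [/= _ _ xy] <-].
    by rewrite lee_fin ler_pdivrMr ?sub_gt0.
  have fin : alpha \is a fin_num.
    by rewrite ge0_fin_numE ?(le_lt_trans alphaK) ?ltry// ltW.
  by exists (fine alpha); [rewrite -lte_fin fineK|rewrite fineK].
have beta_ge0 : (0 <= beta)%E.
  apply: le_trans (beta_ub _ _ Cx0 Cy0 xy0).
  apply: mule_ge0; last by rewrite lee_fin divr_ge0// norm_ge0.
  by apply: mule_ge0; [exact: vol_ge0|rewrite inve_ge0 vol_ge0].
clearbody alpha beta; subst alpha.
(* When [beta] is infinite, so is the right-hand side, as [alpha > 0]. *)
rewrite -EFinM; have [->|beta_fin] := eqVneq beta +oo%E.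
  by rewrite gt0_muley ?leey// lte_fin mulr_gt0.
have [b b0 betaE] : exists2 b, 0 <= b & beta = b%:E.
  have fin : beta \is a fin_num by rewrite ge0_fin_numE// ltey.
  by exists (fine beta); [exact: fine_ge0|rewrite fineK].
subst beta; rewrite -EFinM; apply/lee_addgt0Pr => e e0; rewrite -EFinD.
apply: ereal_inf_lbound; exists (4 * a * b + e) => //; split.
  by rewrite ltr_wpDl// !mulr_ge0// ltW.
move=> Delta Delta0; apply: (exists_separating_partition closedC a0 b0) => //.
- move=> x y Cx Cy; have [->|/eqP xy] := eqVneq x y.
    by rewrite subrr !norm0 mulr0.
  by rewrite -ler_pdivrMr ?sub_gt0// -lee_fin; exact: alpha_ub.
- exact: beta_ub.
- by rewrite ltrDl.
Qed.
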